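(* Let $G=(V,E)$ be a finite simple strongly connected directed graph. Then $$F_{\mathcal TG}=\Phi_G\,F_G,\qquad \Phi_G=\prod_{\substack{W\subsetneq V\\ W\text{ strongly connected}}}\left(\Psi_{V\setminus W}\right)^{m(W)},$$ where the product is over all nonempty proper strongly connected subsets $W$ of $V$.
   Context: $G=(V,E)$ is a finite simple directed graph with edge indeterminates $x_e$. A spanning tree of $G$ is a subgraph on all vertices, with no cycle, one vertex (root) of outdegree $0$ and all others of outdegree $1$. For nonempty $U\subseteq V$, a forest rooted in $U$ is a subgraph on all vertices with no cycle in which vertices of $U$ have outdegree $0$ and all others outdegree $1$. The weight of a tree or forest is the product of $x_e$ over its edges. The tree graph $\mathcal TG$: its vertices are the spanning trees of $G$; for a tree $\mathbf a$ rooted at $r$ and $e\in E$ with $s(e)=r$, the tree $\mathbf b$ obtained from $\mathbf a$ by adding $e$ and deleting the edge of $\mathbf a$ going out of $t(e)$ yields an edge $\mathbf a\to\mathbf b$ of $\mathcal TG$ of weight $x_e$; spanning trees of $\mathcal TG$ (rooted anywhere) are weighted by the product of their edge weights. $F_G$ (resp. $F_{\mathcal TG}$) is the sum of weights of all spanning trees of $G$ (resp. $\mathcal TG$), and $\Psi_U$ is the sum of weights of all forests of $G$ rooted in $U$. Exploration algorithm (depends on a fixed total order of $V$). Input: a spanning tree $\mathbf a$ rooted at $v$. Initialize $A=\{v\}$, $F=\{e: s(e)\neq v\}$, $\mathbf L$ = FIFO list of edges with target $v$, by increasing source. While $\mathbf L$ is nonempty, take its first edge $e$, with source $w$: if $e\in\mathbf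 a$, add $w$ to $A$, delete from $\mathbf L$ (and $F$) all edges with source $w$, and append to $\mathbf L$ all edges of $F$ with target $w$ by increasing source; otherwise delete from $\mathbf L$ and $F$ all edges with source or target $w$. At the end $\phi(\mathbf a)=A$ and $\psi(\mathbf a)$ is the strongly connected component of $v$ in the induced graph $G_{\phi(\mathbf a)}$. For $W$ strongly connected and $w\in W$, $m(W,w)$ is the number of spanning trees $\mathbf a$ rooted at $w$ with $\psi(\mathbf a)=W$; $m(W)$ denotes this number, which is independent of $w\in W$. *)

(* Defs.v *)
From HB Require Import structures.
From mathcomp Require Import all_boot all_order all_algebra.
Set Implicit Arguments. Unset Strict Implicit. Unset Printing Implicit Defensive.
Import GRing.Theory.
Local Open Scope ring_scope.

(* A simple directed graph on a finite vertex type X is a relation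
   [ed : rel X] (irreflexive = no loops; a relation has no multi-edges).
   An edge is a pair e = (s(e), t(e)). Subgraphs are sets of edges. *)

Section Generic.
Variables (X : finType) (ed : rel X).

Definition outdeg (T : {set X * X}) (v : X) : nat := #|[set f in T | f.1 == v]|.

Definition acyclic (T : {set X * X}) : bool :=
  [forall f in T, ~~ connect (fun a b => (a, b) \in T) f.2 f.1].

Definition subgraph (T : {set X * X}) : bool := [forall f in T, ed f.1 f.2].

Definition rooted_forest (T : {set X * X}) (U : {set X}) : bool :=
  [&& subgraph T, [forall v, outdeg T v == (v \notin U)] & acyclic T].

Definition rooted_tree (T : {set X * X}) (r : X) : bool :=
  [&& subgraph T, [forall v, outdeg T v == (v != r)] & acyclic T].

Definition spanning_tree (T : {set X * X}) : bool := [exists r, rooted_tree T r].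

Variable R : comNzRingType.
Variable w : X -> X -> R.

Definition weight (T : {set X * X}) : R := \prod_(f in T) w f.1 f.2.

Definition Ftree : R := \sum_(T : {set X * X} | spanning_tree T) weight T.

Definition Psi (U : {set X}) : R :=
  \sum_(T : {set X * X} | rooted_forest T U) weight T.

Definition induced (W : {set X}) : rel X := fun a b => [&& ed a b, a \in W & b \in W].

Definition strongly_connected (W : {set X}) : bool :=
  (W != set0) && [forall u in W, forall v in W, connect (induced W) u v].

Definition scc_in (A : {set X}) (v : X) : {set X} :=
  [set u in A | connect (induced A) v u && connect (induced A) u v].

End Generic.

Section TreeGraph.
Variables (V : finType) (E : rel V) (R : comNzRingType) (x : V -> V -> R).

Definition TGvert := {T : {set V * V} | spanning_tree E T}.

Definition tg_step (a : {set V * V}) (e : V * V) (b : {set V * V}) : bool :=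
  [&& E e.1 e.2, rooted_tree E a e.1 &
      b == (a :\: [set f in a | f.1 == e.2]) :|: [set e]].

Definition TGrel : rel TGvert := fun a b => [exists e, tg_step (val a) e (val b)].

(* weight of the TG edge a -> b is x_e (the edge e is unique) *)
Definition TGweight (a b : TGvert) : R :=
  \sum_(e : V * V | tg_step (val a) e (val b)) x e.1 e.2.

Definition F_G : R := Ftree E x.
Definition F_TG : R := Ftree TGrel TGweight.
End TreeGraph.

(* The fixed total order on V is the enumeration order of V (for V = 'I_n,
   the natural order). State = (A, F, L). *)
Section Exploration.
Variables (V : finType) (E : rel V).

Definition explore_step (a : {set V * V})
    (st : {set V} * {set V * V} * seq (V * V)) :=
  let: (A, F, L) := st in
  match L with
  | [::] => st
  | e :: L' =>
      let w := e.1 in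
      if e \in a then
        let F' := [set f in F | f.1 != w] in
        (w |: A, F',
         [seq f <- L' | f.1 != w] ++ [seq (u, w) | u <- enum V & (u, w) \in F'])
      else
        let F' := [set f in F | (f.1 != w) && (f.2 != w)] in
        (A, F', [seq f <- L' | (f.1 != w) && (f.2 != w)])
  end.

(* each step removes at least one edge from F, and L is contained in F, so
   #|V * V|.+1 iterations reach the end of the loop *)
Definition explore (a : {set V * V}) (v : V) :=
  iter #|{: V * V}|.+1 (explore_step a)
    ([set v], [set f : V * V | E f.1 f.2 && (f.1 != v)],
     [seq (u, v) | u <- enum V & E u v]).

Definition phi (a : {set V * V}) (v : V) : {set V} := (explore a v).1.1.

Definition psi (a : {set V * V}) (v : V) : {set V} := scc_in E (phi a v) v.

Definition mult (W : {set V}) (w : V) : nat :=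
  #|[set a : {set V * V} | rooted_tree E a w && (psi a w == W)]|.

(* m(W) := m(W, w) for a chosen w in W (independent of w by the paper) *)
Definition mW (W : {set V}) : nat :=
  if [pick w in W] is Some w then mult W w else 0.

Variables (R : comNzRingType) (x : V -> V -> R).

Definition Phi : R :=
  \prod_(W : {set V} | strongly_connected E W && (W \proper setT))
     Psi E x (~: W) ^+ mW W.
End Exploration.

(* Main.v *)
Require Import Defs.
From HB Require Import structures.
From mathcomp Require Import all_boot all_order all_algebra all_fingroup.
From mathcomp Require Import mpoly.
Set Implicit Arguments. Unset Strict Implicit. Unset Printing Implicit Defensive.
Import GRing.Theory.
Local Open Scope ring_scope.

(* Let M be a matrix supported on the edges and loops of G, and TM its lift to the tree graph: from
   a tree rooted at r one moves along (r, t) with weight M r t.  The theorem follows from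
     det (1 - TM) = prod_W det (1 - M_W) ^ m(W),  W strongly connected,
   where M_W is M with the rows outside W zeroed.  Both sides have constant term 1 after scaling M
   by a variable, so over a torsion-free ring it suffices to compare the traces of the powers.
   A closed walk of G with set of vertices A lifts to one closed walk for each tree that it fixes.
   Such a tree is determined on A by the last exits of the walk, and its other edges form an
   arbitrary forest rooted in A.  On the other side one needs the sum of the m(W) over the strongly
   connected W containing A to be the number of these forests.  It is: if A is strongly connected
   and contains v, a tree a rooted at v with A contained in phi(a) is recovered from the forest left
   by deleting its edges out of A, because each vertex of A other than v must leave by the first of
   its edges that the exploration examines.
   Take 1 - M = y + L with L the Laplacian of G; then 1 - TM = y + L_TG.  In the coefficient of y,
   the factor W = V, for which m(V) = 1, contributes F_G, and every other factor contributes
   its value Psi_(V \ W) at y = 0.  The weights are first taken to be indeterminates over the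
   integers, which makes the ring torsion-free. *)

(** * Derivatives of determinants and logarithmic derivatives of polynomials *)

Lemma deriv_prod (R : comNzRingType) (I : finType) (F : I -> {poly R}) :
  (\prod_i F i)^`() = \sum_i (F i)^`() * \prod_(j | j != i) F j.
Proof.
have D (s : seq I) : uniq s -> (\prod_(i <- s) F i)^`() =
    \sum_(i <- s) (F i)^`() * \prod_(j <- s | j != i) F j.
  elim: s => [|a s IHs] /=; first by rewrite !big_nil derivC.
  case/andP=> aNs us; rewrite !big_cons eqxx /= derivM IHs //; congr (_ + _).
    rewrite big_seq_cond [in RHS]big_seq_cond; congr (_ * _); apply: eq_bigl => j.
    by rewrite andbT; case js: (j \in s) => //=; apply/esym/eqP => ja; rewrite -ja js in aNs.
  rewrite mulr_sumr; apply: eq_big_seq => i is_; rewrite big_cons.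
  case: eqP => [ai|_]; first by rewrite ai is_ in aNs.
  by rewrite mulrCA.
by have := D _ (index_enum_uniq I).
Qed.

Lemma deriv_det (R : comNzRingType) m (C : 'M[{poly R}]_m) :
  (\det C)^`() =
  \sum_i \det (\matrix_(i', j) (if i' == i then (C i j)^`() else C i' j)).
Proof.
rewrite /determinant raddf_sum exchange_big /=; apply: eq_bigr => s _.
rewrite -mulr_sumr -signr_odd; set b := odd _.
have -> (p : {poly R}) : ((-1) ^+ b * p)^`() = (-1) ^+ b * p^`().
  by rewrite [b]lock; case: (locked b); rewrite ?expr0 ?mul1r // expr1 !mulN1r derivN.
congr (_ * _); rewrite deriv_prod; apply: eq_bigr => i _.
rewrite [in RHS](bigD1 i) //= !mxE eqxx; congr (_ * _).
by apply: eq_bigr => j ji; rewrite mxE (negPf ji).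
Qed.

(** Jacobi's formula: expand each summand of [deriv_det] along its differentiated row, on which the
    cofactors do not depend. *)
Lemma deriv_det_adj (R : comNzRingType) m (C : 'M[{poly R}]_m) :
  (\det C)^`() = \tr (map_mx deriv C *m \adj C).
Proof.
rewrite deriv_det; apply: eq_bigr => i _; rewrite (expand_det_row _ i) mxE.
apply: eq_bigr => j _; rewrite !mxE eqxx; congr (_ * _).
rewrite /cofactor; congr (_ * \det _); apply/matrixP => k l.
by rewrite !mxE eq_sym (negPf (neq_lift _ _)).
Qed.

(* [P] is the exponential of [- \sum_i t i X^(i+1) / (i+1)], without denominators. *)
Definition log_deriv (R : comNzRingType) (P : {poly R}) (t : nat -> R) :=
  forall N, exists q, P^`() = - (P * \poly_(i < N) t i) + 'X^N * q.

Lemma log_deriv1 (R : comNzRingType) : log_deriv (1 : {poly R}) (fun=> 0).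
Proof.
move=> N; exists 0; rewrite mulr0 addr0 mul1r derivC.
by rewrite (_ : \poly_(i < N) 0 = 0) ?oppr0 //; apply/polyP=> i; rewrite coef_poly coef0 if_same.
Qed.

Lemma log_derivM (R : comNzRingType) (P Q : {poly R}) t s :
  log_deriv P t -> log_deriv Q s -> log_deriv (P * Q) (fun k => t k + s k).
Proof.
move=> HP HQ N; have [p Ep] := HP N; have [q Eq] := HQ N.
exists (p * Q + P * q); rewrite derivM Ep Eq.
have -> : \poly_(i < N) (t i + s i) = \poly_(i < N) t i + \poly_(i < N) s i.
  by apply/polyP=> i; rewrite coefD !coef_poly; case: ifP; rewrite ?addr0.
rewrite !mulrDl !mulrDr mulNr mulrN !mulrA.
rewrite [P * _ * Q]mulrAC ['X^N * p * Q]mulrAC ['X^N * P]mulrC !opprD.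
by rewrite -!addrA; congr (_ + _); rewrite addrCA; congr (_ + _); rewrite mulrAC.
Qed.

Lemma log_derivX (R : comNzRingType) (P : {poly R}) t m :
  log_deriv P t -> log_deriv (P ^+ m) (fun k => t k *+ m).
Proof.
move=> HP; elim: m => [|m IHm]; first exact: log_deriv1.
by rewrite exprS => N; have [q Eq] := log_derivM HP IHm N; exists q; rewrite Eq; 
  congr (- (_ * _) + _); apply/polyP=> i; rewrite !coef_poly mulrS.
Qed.

Lemma log_deriv_prod (R : comNzRingType) (I : finType) (S : pred I)
    (P : I -> {poly R}) (t : I -> nat -> R) :
  (forall i, S i -> log_deriv (P i) (t i)) ->
  log_deriv (\prod_(i | S i) P i) (fun k => \sum_(i | S i) t i k).
Proof.
move=> HP; elim: (index_enum I) => [|i s IHs] N.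
  have [q Eq] := log_deriv1 R N; exists q; rewrite !big_nil Eq.
  by congr (- (_ * _) + _); apply/polyP=> k; rewrite !coef_poly big_nil.
rewrite big_cons; case Si: (S i).
  have [q Eq] := log_derivM (HP i Si) IHs N; exists q; rewrite Eq.
  by congr (- (_ * _) + _); apply/polyP=> k; rewrite !coef_poly big_cons Si.
have [q Eq] := IHs N; exists q; rewrite Eq.
by congr (- (_ * _) + _); apply/polyP=> k; rewrite !coef_poly big_cons Si.
Qed.

(** By Jacobi's formula, since [\adj C] is [\det C] times the inverse of [C], a geometric series in
    ['X *: B]. Its truncation to [N] terms is [S], and the tail goes into [q]. *)
Lemma log_deriv_det (R : comNzRingType) m (B : 'M[R]_m) :
  log_deriv (\det (1%:M - 'X *: map_mx polyC B)) (fun k => \tr (B ^+ k.+1)).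
Proof.
move=> N; set B' := map_mx polyC B; set C := _ - _.
have EB k : B' ^+ k = map_mx polyC (B ^+ k).
  elim: k => [|k IHk]; first by rewrite !expr0 map_mx1.
  by rewrite !exprS IHk -[in LHS]/(B' *m _) -[in RHS]/(B *m _) map_mxM.
have [S [ES CS]] : exists S, \tr (B' *m S) = \poly_(i < N) \tr (B ^+ i.+1) /\
    C *m S = 1%:M - 'X^N *: B' ^+ N.
  exists (\sum_(i < N) 'X^i *: B' ^+ i); split.
    rewrite poly_def mulmx_sumr raddf_sum; apply: eq_bigr => i _ /=.
    rewrite -scalemxAr mxtraceZ -[B' *m _]exprS EB trace_map_mx.
    by rewrite mulrC mul_polyC.
  elim: N => [|N IHN]; first by rewrite big_ord0 mulmx0 !expr0 scale1r subrr.
  rewrite big_ord_recr mulmxDr IHN /= /C mulmxBl mul1mx -scalemxAl -scalemxAr scalerA.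
  by rewrite -!exprS -[B' *m _]exprS addrA subrK.
have := deriv_det_adj C.
have -> : map_mx deriv C = - B'.
  apply/matrixP=> i j; rewrite !mxE derivB derivM derivX derivC mulr0 addr0 mul1r.
  by case: (i == j); rewrite derivC sub0r.
have -> : \adj C = \det C *: S + 'X^N *: (\adj C *m B' ^+ N).
  have := congr1 (mulmx (\adj C)) CS; rewrite mulmxA mul_adj_mx mul_scalar_mx => ->.
  by rewrite mulmxBr mulmx1 -scalemxAr subrK.
rewrite mulNmx mulmxDr -!scalemxAr !raddfN !raddfD /= !mxtraceZ ES -mulrN => ->.
by exists (- \tr (B' *m (\adj C *m B' ^+ N))); rewrite !mulrN.
Qed.

(** The derivative expresses [k.+1] times the coefficient of degree [k.+1] through the lower
    coefficients; torsion-freeness cancels the factor [k.+1]. *)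
Lemma log_deriv_uniq (R : comNzRingType) (P Q : {poly R}) t :
  (forall n (z : R), z *+ n.+1 = 0 -> z = 0) ->
  log_deriv P t -> log_deriv Q t -> P`_0 = Q`_0 -> P = Q.
Proof.
move=> tf HP HQ E0; apply/polyP=> k; have [n] := ubnP k; elim: n k => // n IHn [|k] // ltkn.
have coefS (S : {poly R}) : log_deriv S t -> S`_k.+1 *+ k.+1 = - \sum_(i < k.+1) S`_i * t (k - i)%N.
  move=> /(_ k.+1) [q Eq]; rewrite -coef_deriv Eq coefD coefN coefXnM ltnSn addr0 coefM.
  by congr (- _); apply: eq_bigr => i _; rewrite coef_poly ltnS leq_subr.
apply/eqP; rewrite -subr_eq0; apply/eqP/(tf k); rewrite mulrnBl coefS // coefS //.
apply/eqP; rewrite subr_eq0; apply/eqP; congr (- _); apply: eq_bigr => i _.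
by rewrite IHn // (leq_trans (ltn_ord i)).
Qed.

(** Scaling the matrices by ['X] gives polynomials with constant term 1 and the same logarithmic
    derivative. They agree by [log_deriv_uniq], and evaluation at 1 removes the scaling. *)
Lemma det_eq_prod_of_traces (R : comNzRingType) (I : finType) (S : pred I) (e : I -> nat)
    m (B : 'M[R]_m) k (C : I -> 'M[R]_k) :
  (forall n (z : R), z *+ n.+1 = 0 -> z = 0) ->
  (forall n, \tr (B ^+ n.+1) = \sum_(i | S i) \tr (C i ^+ n.+1) *+ e i) ->
  \det (1%:M - B) = \prod_(i | S i) \det (1%:M - C i) ^+ e i.
Proof.
move=> tf trE.
have hE (a : R) l (D : 'M[R]_l) :
    (\det (1%:M - 'X *: map_mx polyC D)).[a] = \det (1%:M - a *: D).
  rewrite -horner_evalE -det_map_mx; congr (\det _); apply/matrixP=> i j.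
  by rewrite !mxE /= horner_evalE hornerD hornerN hornerM hornerX !hornerE hornerMn hornerE.
have -> : \det (1%:M - B) = (\det (1%:M - 'X *: map_mx polyC B)).[1].
  by rewrite hE scale1r.
rewrite (@log_deriv_uniq _ _ (\prod_(i | S i)
    \det (1%:M - 'X *: map_mx polyC (C i)) ^+ e i) _ tf (log_deriv_det B)).
- by rewrite horner_prod; apply: eq_bigr => i _; rewrite horner_exp hE scale1r.
- have HP i : S i -> _ := fun _ => log_derivX (e i) (log_deriv_det (C i)).
  move=> N; have [q Eq] := log_deriv_prod HP N; exists q; rewrite Eq.
  by congr (- (_ * _) + _); apply/polyP=> n; rewrite !coef_poly trE.
rewrite -!horner_coef0 hE scale0r subr0 det1 horner_prod big1 // => i _.
by rewrite horner_exp hE scale0r subr0 det1 expr1n.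
Qed.

(** * The matrix forest theorem *)

(* Forests rooted in [U], encoded by their parent function (the identity on the roots). *)
Definition fun_forest (X : finType) (ed : rel X) (U : {set X}) (g : {ffun X -> X}) : bool :=
  [forall u, if u \in U then g u == u else ed u (g u)] &&
  [forall u, exists r in U, fconnect g u r].

Lemma iter_fixed (T : Type) (f : T -> T) x k : f x = x -> iter k f x = x.
Proof. by move=> fx; elim: k => //= k ->. Qed.

Lemma fconnectP (X : finType) (f : X -> X) x y :
  reflect (exists k, y = iter k f x) (fconnect f x y).
Proof.
apply: (iffP idP) => [/iter_findex <-|[k ->]]; last exact: fconnect_iter.
by exists (findex f x y).
Qed.

Section MatrixForest.
Variables (X : finType) (R : comNzRingType).
Implicit Types (U : {set X}) (g : {ffun X -> X}) (w : X -> X -> R).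

Definition laplacian w U : 'M[R]_#|X| := \matrix_(i, j)
  if enum_val i \in U then (enum_val i == enum_val j)%:R
  else (enum_val i == enum_val j)%:R * (\sum_t w (enum_val i) t)
       - w (enum_val i) (enum_val j).

Definition parent_mx g U : 'M[R]_#|X| := \matrix_(i, j)
  if enum_val i \in U then (enum_val i == enum_val j)%:R
  else (enum_val i == enum_val j)%:R - (g (enum_val i) == enum_val j)%:R.

(** Multilinearity in the rows: row [u] combines, over the possible parents [t] of [u], the rows
    that [parent_mx] has when [g u = t]. For a root, only [g u = u] has a nonzero coefficient. *)
Lemma det_laplacian w U : \det (laplacian w U) =
  \sum_(g : {ffun X -> X}) (\prod_u if u \in U then (g u == u)%:R else w u (g u)) * \det (parent_mx g U).
Proof.
rewrite /determinant.
under [RHS]eq_bigr do rewrite mulr_sumr.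
rewrite exchange_big /=; apply: eq_bigr => s _.
under [RHS]eq_bigr do rewrite mulrCA.
rewrite -mulr_sumr; congr (_ * _).
pose d u t v : R := if u \in U then (u == v)%:R else (u == v)%:R - (t == v)%:R.
pose c u t : R := if u \in U then (t == u)%:R else w u t.
transitivity (\prod_u \sum_t c u t * d u t (enum_val (s (enum_rank u)))).
  rewrite [RHS](reindex_onto enum_val enum_rank) => [|u _]; last by rewrite enum_rankK.
  apply: eq_big => i; rewrite enum_valK ?eqxx // => _.
  rewrite mxE /c /d; case: ifP => _.
    rewrite (bigD1 (enum_val i)) //= eqxx mul1r big1 ?addr0 // => t /negPf->.
    by rewrite mul0r.
  under [RHS]eq_bigr do rewrite mulrBr.
  rewrite sumrB -mulr_suml mulrC; congr (_ - _).
  rewrite (bigD1 (enum_val (s i))) //= eqxx mulr1 big1 ?addr0 // => t /negPf->.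
  by rewrite mulr0.
rewrite bigA_distr_bigA; apply: eq_bigr => g _; rewrite big_split; congr (_ * _).
rewrite [LHS](reindex_onto enum_val enum_rank) => [|u _]; last by rewrite enum_rankK.
by apply: eq_big => i; rewrite enum_valK ?eqxx // mxE.
Qed.

(* A permutation contributing to the determinant moves each [u] to [u] or [g u]; along a
   nontrivial cycle it follows [g] forever and never meets [U]. *)
Lemma det_parent_forest ed g U :
  irreflexive ed -> fun_forest ed U g -> \det (parent_mx g U) = 1.
Proof.
move=> irr /andP[/forallP loc /forallP reach].
rewrite /determinant (bigD1 (1%g : {perm _})) //= [X in _ + X]big1 ?addr0.
  rewrite odd_perm1 expr0 mul1r big1 // => i _; rewrite mxE perm1 eqxx.
  case: ifP => // uU; have := loc (enum_val i); rewrite uU.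
  by case: eqP => [->|]; rewrite ?irr ?subr0.
move=> s sN1; apply/eqP; apply: contraT => nz; case/negP: sN1; apply/eqP/permP => i0.
rewrite perm1; apply/eqP; apply: contraT => si0.
have step i : s i != i -> enum_val (s i) = g (enum_val i) /\ enum_val i \notin U.
  move=> sii; have : parent_mx g U i (s i) != 0.
    by apply: contraNneq nz => z; rewrite (bigD1 i) //= z mul0r mulr0.
  rewrite mxE (inj_eq enum_val_inj) [i == _]eq_sym (negPf sii) sub0r.
  case: ifP => // _; first by rewrite eqxx.
  by case: (g _ =P _) => [->|_]; rewrite ?oppr0 ?eqxx.
have orb k : s (iter k s i0) != iter k s i0 /\ enum_val (iter k s i0) = iter k g (enum_val i0).
  elim: k => [|k [IH1 IH2]] /=; first by [].
  by rewrite (inj_eq perm_inj) IH1; split=> //; case: (step _ IH1) => -> _; rewrite IH2.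
have /existsP[r /andP[rU /fconnectP[k Er]]] := reach (enum_val i0).
have [o1 o2] := orb k; have [_] := step _ o1.
by rewrite o2 -Er rU.
Qed.

(** The indicator vector of the set [Z] of vertices that never reach [U] is in the kernel.
    Multiplying by the adjugate, the determinant kills its coordinate at [v], which is 1. *)
Lemma det_parent_nreach g U v :
  (forall u, u \in U -> g u = u) ->
  (forall r, r \in U -> ~~ fconnect g v r) -> \det (parent_mx g U) = 0.
Proof.
move=> gU nv.
pose Z := [set u | [forall r in U, ~~ fconnect g u r]].
have gZ u : u \notin U -> (g u \in Z) = (u \in Z).
  move=> uU; rewrite !inE; apply: eq_forallb => r; case rU: (r \in U) => //=.
  congr (~~ _); apply/fconnectP/fconnectP => [[k ->]|[[|k] E]].
  - by exists k.+1; rewrite iterSr.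
  - by rewrite E /= (negPf uU) in rU.
  - by exists k; rewrite E iterSr.
have UZ u : u \in U -> u \notin Z.
  by move=> uU; rewrite inE; apply/negP => /forallP/(_ u); rewrite uU connect0.
pose z : 'cV[R]_#|X| := \col_i (enum_val i \in Z)%:R.
have Dz : parent_mx g U *m z = 0.
  apply/colP=> i; rewrite !mxE.
  have S a : \sum_(j < #|X|) (a == enum_val j)%:R * z j 0 = (a \in Z)%:R :> R.
    rewrite (bigD1 (enum_rank a)) //= enum_rankK eqxx mul1r mxE enum_rankK big1 ?addr0 // => j ja.
    case: eqP => [E|]; last by rewrite mul0r.
    by rewrite E enum_valK eqxx in ja.
  case uU: (enum_val i \in U).
    under eq_bigr do rewrite [parent_mx _ _ _ _]mxE uU.
    by rewrite S (negPf (UZ _ uU)).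
  under eq_bigr do rewrite [parent_mx _ _ _ _]mxE uU mulrBl.
  by rewrite sumrB !S gZ ?uU // subrr.
have := congr1 (mulmx (\adj (parent_mx g U))) Dz.
rewrite mulmxA mul_adj_mx mulmx0 mul_scalar_mx => /colP/(_ (enum_rank v)).
rewrite !mxE enum_rankK; suff -> : v \in Z by rewrite mulr1.
by rewrite inE; apply/forallP=> r; apply/implyP/nv.
Qed.

(** In [det_laplacian], a function that moves a root or uses a non-edge has coefficient 0, one with
    a vertex that misses [U] has determinant 0, and a forest has determinant 1. *)
Lemma matrix_forest ed w U : irreflexive ed -> (forall u v, ~~ ed u v -> w u v = 0) ->
  \det (laplacian w U) =
  \sum_(g : {ffun X -> X} | fun_forest ed U g) \prod_(u | u \notin U) w u (g u).
Proof.
move=> irr w0; rewrite det_laplacian [RHS]big_mkcond /=; apply: eq_bigr => g _.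
case: ifP => [F|].
  rewrite (det_parent_forest irr F) mulr1 [RHS]big_mkcond; apply: eq_bigr => u _.
  case/andP: F => /forallP/(_ u); case: ifP => // _ /eqP->; by rewrite eqxx.
case loc: [forall u, if u \in U then g u == u else ed u (g u)]; last first.
  move/negbT: loc; rewrite negb_forall => /existsP[u Hu] _.
  rewrite (bigD1 u) //=; case: ifP Hu => _; first by move/negPf->; rewrite !mul0r.
  by move=> nE; rewrite w0 // !mul0r.
rewrite /fun_forest loc /= => /negbT; rewrite negb_forall => /existsP[v].
rewrite negb_exists => /forallP nv.
rewrite (@det_parent_nreach g U v) ?mulr0 // => [u uU|r rU].
  by move/forallP/(_ u): loc; rewrite uU => /eqP.
by have := nv r; rewrite rU.
Qed.

End MatrixForest.

(** * Edge sets and their parent functions *)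

Section EdgeSets.
Variable X : finType.
Implicit Types (ed : rel X) (U : {set X}) (g : {ffun X -> X}) (T : {set X * X}).

Definition fun_edges g : {set X * X} := [set f | (g f.1 == f.2) && (f.1 != f.2)].

Definition parent_fun T : {ffun X -> X} :=
  [ffun u => if [pick v | (u, v) \in T] is Some v then v else u].

Lemma fun_edgesK : cancel fun_edges parent_fun.
Proof.
move=> g; apply/ffunP=> u; rewrite ffunE; case: pickP => [v|nv].
  by rewrite inE => /andP[/eqP].
by have := nv (g u); rewrite inE eqxx /= => /negbFE/eqP.
Qed.

Lemma outdeg_fun_edges g v : outdeg (fun_edges g) v = (g v != v).
Proof.
rewrite /outdeg; case: eqP => [E|/eqP nE].
  rewrite (_ : [set f in _ | _] = set0) ?cards0 //; apply/setP=> -[a b]; rewrite !inE /=.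
  by case: (a =P v) => [->|]; rewrite ?andbF // E andbT andbN.
rewrite (_ : [set f in _ | _] = [set (v, g v)]) ?cards1 //; apply/setP=> -[a b].
rewrite !inE /= xpair_eqE; case: (a =P v) => [->|] /=; rewrite ?andbF // andbT eq_sym.
by case: eqP => // ->; rewrite eq_sym.
Qed.

Lemma rooted_treeE ed T r : rooted_tree ed T r = rooted_forest ed T [set r].
Proof.
by rewrite /rooted_forest /rooted_tree; congr [&& _, _ & _]; apply: eq_forallb => v; rewrite inE.
Qed.

Lemma connect_fun_edges g x y :
  connect (fun a b => (a, b) \in fun_edges g) x y -> fconnect g x y.
Proof.
apply: connect_sub x y => a b; rewrite inE /= => /andP[E _].
exact: (connect1 (e := frel g)).
Qed.

(** An orbit avoiding [U] eventually repeats, and its edges close a cycle. Conversely, a vertex on a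
    cycle is periodic while its orbit is absorbed by a root; so it is that root, which has no
    outgoing edge. *)
Lemma acyclic_fun_edges g U : (forall u, (g u == u) = (u \in U)) ->
  acyclic (fun_edges g) = [forall u, exists r in U, fconnect g u r].
Proof.
move=> gU; apply/forallP/forallP => [ac u|reach f].
  apply: contraT; rewrite negb_exists => /forallP nr.
  have nU k : iter k g u \notin U.
    by have := nr (iter k g u); rewrite fconnect_iter andbT.
  have cn i k : connect (fun a b => (a, b) \in fun_edges g) (iter i g u) (iter (k + i) g u).
    elim: k => [|k IHk]; first exact: connect0.
    apply: connect_trans IHk (connect1 _); rewrite inE /= eqxx eq_sym gU.
    exact: nU.
  have /trajectP[i lti E] := looping_order g u.
  have := ac (iter i g u, iter i.+1 g u).
  rewrite inE /= eqxx eq_sym gU nU /=; case/negP.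
  by have := cn i.+1 (fingraph.order g u - i.+1)%N; rewrite subnK // E.
apply/implyP=> fT; apply/negP => /connect_fun_edges/fconnectP[k].
have := fT; rewrite inE => /andP[/eqP <- nE] E.
have per m : iter (m * k.+1) g f.1 = f.1.
  by elim: m => // m IHm; rewrite mulSn iterD IHm iterSr -E.
have /existsP[r /andP[rU /fconnectP[j Er]]] := reach f.1.
have fr : f.1 = r.
  (* After [j * k.+1] steps the orbit is back at [f.1], but it has been constant at [r] since step
     [j]. *)
  rewrite -(per j) -(@subnK j (j * k.+1)) ?leq_pmulr // iterD -Er iter_fixed //.
  by apply/eqP; rewrite gU.
by move: nE; rewrite eq_sym gU fr rU.
Qed.

Lemma rooted_forest_fun_edges ed g U : irreflexive ed ->
  rooted_forest ed (fun_edges g) U = fun_forest ed U g.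
Proof.
move=> irr; rewrite /rooted_forest /fun_forest andbA.
have -> : subgraph ed (fun_edges g) && [forall v, outdeg (fun_edges g) v == (v \notin U)] =
    [forall u, if u \in U then g u == u else ed u (g u)].
  apply/andP/forallP => [[/forallP sg /forallP od] u|loc].
    have := od u; rewrite outdeg_fun_edges; case: ifP => uU; first by case: (g u =P u).
    case: (g u =P u) => // /eqP nE _; have := sg (u, g u).
    by rewrite inE /= eqxx eq_sym nE.
  split; apply/forallP.
    case=> a b; rewrite inE /=; apply/implyP => /andP[/eqP <- nE].
    by have := loc a; rewrite eq_sym (negPf nE); case: ifP.
  move=> v; rewrite outdeg_fun_edges; have := loc v; case: ifP => _; first by move->.
  by case: (g v =P v) => // ->; rewrite irr.
case loc: [forall u, _] => //=; apply: acyclic_fun_edges => u.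
move/forallP/(_ u): loc; case: ifP => // _; by case: eqP => // ->; rewrite irr.
Qed.

Lemma parent_funK ed T U : irreflexive ed -> rooted_forest ed T U ->
  fun_edges (parent_fun T) = T.
Proof.
move=> irr /and3P[/forallP sg /forallP od _]; apply/setP=> -[a b].
have uq c : (a, b) \in T -> (a, c) \in T -> b = c.
  move=> bT cT; have := od a; rewrite /outdeg => /eqP oda.
  have /card_le1_eqP/(_ (a, b) (a, c)) : (#|[set f in T | f.1 == a]| <= 1)%N.
    by rewrite oda; case: (_ \in _).
  by rewrite !inE bT cT /= eqxx => /(_ isT isT) [].
rewrite inE ffunE /=; case: pickP => [c cT|nc].
  apply/andP/idP => [[/eqP <- _] //|bT]; rewrite (uq c) //; split=> //.
  by apply/eqP => ac; have := sg (a, c); rewrite cT /= -ac irr.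
by rewrite andbN; apply/esym/nc.
Qed.

Lemma weight_fun_edges (R : comNzRingType) (w : X -> X -> R) ed g U :
  irreflexive ed -> fun_forest ed U g ->
  weight w (fun_edges g) = \prod_(u | u \notin U) w u (g u).
Proof.
move=> irr /andP[/forallP loc _]; rewrite /weight.
have -> : fun_edges g = [set (u, g u) | u in ~: U].
  apply/setP=> -[a b]; apply/idP/imsetP => [|[u]].
    rewrite inE /= => /andP[/eqP <- nE]; exists a => //; rewrite inE.
    by apply/negP => aU; have := loc a; rewrite aU eq_sym (negPf nE).
  rewrite inE => uU [-> ->]; rewrite inE /= eqxx /=; have := loc u.
  by rewrite (negPf uU); apply: contraTneq => <-; rewrite irr.
rewrite big_imset => [|u v _ _ []] //=.
by apply: eq_bigl => u; rewrite inE.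
Qed.

Lemma sum_rooted_forest (R : comNzRingType) (F : {set X * X} -> R) ed U : irreflexive ed ->
  \sum_(T | rooted_forest ed T U) F T =
  \sum_(g : {ffun X -> X} | fun_forest ed U g) F (fun_edges g).
Proof.
move=> irr; rewrite (reindex_onto fun_edges parent_fun) => [|T]; last exact: parent_funK.
by apply: eq_bigl => g; rewrite fun_edgesK eqxx andbT rooted_forest_fun_edges.
Qed.

Lemma Psi_det (R : comNzRingType) (w : X -> X -> R) ed U : irreflexive ed ->
  (forall u v, ~~ ed u v -> w u v = 0) -> Psi ed w U = \det (laplacian w U).
Proof.
move=> irr w0; rewrite (matrix_forest U irr w0) /Psi sum_rooted_forest //.
by apply: eq_bigr => g F; apply: weight_fun_edges F.
Qed.

Lemma rooted_tree_root_uniq ed T r s : rooted_tree ed T r -> rooted_tree ed T s -> r = s.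
Proof.
case/and3P=> _ /forallP/(_ r) /eqP Er _ /and3P[_ /forallP/(_ r)]; rewrite Er eqxx /=.
by case: (r =P s).
Qed.

Lemma Ftree_sum_Psi (R : comNzRingType) (w : X -> X -> R) ed :
  Ftree ed w = \sum_r Psi ed w [set r].
Proof.
rewrite /Ftree /Psi (exchange_big_dep (spanning_tree ed)) /=; last first.
  by move=> r T _ rT; apply/existsP; exists r; rewrite rooted_treeE.
apply: eq_bigr => T /existsP[r rT]; rewrite (big_pred1 r) // => s; rewrite -rooted_treeE.
by apply/idP/eqP => [/rooted_tree_root_uniq/(_ rT)|->].
Qed.

End EdgeSets.

(** * Traces and closed walks *)

Section Traces.
Variables (V : finType) (R : comNzRingType).

Fixpoint words k : seq (seq V) :=
  if k is k'.+1 then [seq t :: p | t <- enum V, p <- words k'] else [:: [::]].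

Fixpoint walk_weight (M : V -> V -> R) v p : R :=
  if p is t :: p' then M v t * walk_weight M t p' else 1.

Variables (X : finType) (root : X -> V) (step : X -> V -> X) (M : V -> V -> R).

(** One definition serves both graphs: trees with their roots and moves give the lift of [M] to the
    tree graph, while [root = id] with [step] returning its second argument gives [M] itself, see
    [lift_mx_id]. *)
Definition lift_mx : 'M[R]_#|X| := \matrix_(i, j)
  \sum_t M (root (enum_val i)) t * (step (enum_val i) t == enum_val j)%:R.

Hypothesis root_step : forall a t, M (root a) t != 0 -> root (step a t) = t.

Lemma sum_pred1 (F : X -> R) a : \sum_b (a == b)%:R * F b = F a.
Proof.
rewrite (bigD1 a) //= eqxx mul1r big1 ?addr0 // => b; rewrite eq_sym => /negPf->.
by rewrite mul0r.
Qed.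

(** By [root_step] the roots met along a lifted walk are the letters of the word, so its weight can
    be computed in [V]. *)
Lemma lift_mxX k i j : (lift_mx ^+ k) i j =
  \sum_(p <- words k) walk_weight M (root (enum_val i)) p *
    (foldl step (enum_val i) p == enum_val j)%:R.
Proof.
elim: k i => [|k IHk] i /=.
  by rewrite expr0 big_seq1 mul1r mxE (inj_eq enum_val_inj).
rewrite exprS mxE big_allpairs_dep /= big_enum /=.
under eq_bigr do rewrite mxE mulr_suml.
rewrite exchange_big /=; apply: eq_bigr => t _.
under eq_bigr do rewrite -mulrA.
rewrite -mulr_sumr.
have [M0|M0] := eqVneq (M (root (enum_val i)) t) 0.
  by rewrite M0 mul0r big1 // => p _; rewrite mul0r mul0r.
under [RHS]eq_bigr do rewrite -mulrA.
rewrite -[RHS]mulr_sumr; congr (_ * _).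
have -> : \sum_(l < #|X|) (step (enum_val i) t == enum_val l)%:R * (lift_mx ^+ k) l j =
   \sum_b (step (enum_val i) t == b)%:R * (lift_mx ^+ k) (enum_rank b) j.
  rewrite [RHS](reindex_onto enum_val enum_rank) => [|u _]; last by rewrite enum_rankK.
  by apply: eq_big => l; rewrite enum_valK ?eqxx.
by rewrite sum_pred1 IHk enum_rankK root_step.
Qed.

Lemma trace_lift_mxX k : \tr (lift_mx ^+ k) =
  \sum_(p <- words k) \sum_a walk_weight M (root a) p * (foldl step a p == a)%:R.
Proof.
rewrite /mxtrace exchange_big /= [RHS](reindex_onto enum_val enum_rank) => [|u _]; last by rewrite enum_rankK.
by apply: eq_big => l; rewrite ?enum_valK ?eqxx // => _; rewrite lift_mxX.
Qed.

End Traces.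

Lemma lift_mx_id (V : finType) (R : comNzRingType) (M : V -> V -> R) :
  lift_mx id (fun _ t => t) M = \matrix_(i, j) M (enum_val i) (enum_val j).
Proof.
apply/matrixP=> i j; rewrite !mxE (bigD1 (enum_val j)) //= eqxx mulr1 big1 ?addr0 //.
by move=> t /negPf->; rewrite mulr0.
Qed.

(** * The action of walks on trees *)

Section WalkFixed.
Variables (V : finType) (E : rel V).
Implicit Types (g h : {ffun V -> V}) (A B U : {set V}).

(* A tree [g] rooted at [r] is moved along the edge [(r, t)]; a loop does nothing. *)
Definition move r g t : {ffun V -> V} := [ffun u => if (u == t) || (u == r) then t else g u].

Fixpoint walk r g p := if p is t :: p' then walk t (move r g t) p' else g.

Lemma move_root r g t : move r g t t = t.
Proof. by rewrite ffunE eqxx. Qed.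

Lemma walk_notin r g p u : u \notin r :: p -> walk r g p u = g u.
Proof.
elim: p r g => //= t p IHp r g; rewrite inE negb_or => /andP[ur utp].
rewrite IHp // ffunE (negPf ur) orbF; case: eqP => // ut.
by rewrite ut mem_head in utp.
Qed.

(** The value at a visited vertex is its last exit, or the vertex itself at the end of the walk;
    neither depends on the initial function. *)
Lemma walk_in r g h p u : u \in r :: p -> g r = r -> h r = r -> walk r g p u = walk r h p u.
Proof.
elim: p r g h => /= [|t p IHp] r g h; first by rewrite inE => /eqP-> -> ->.
have [utp _ gr hr|utp] := boolP (u \in t :: p); first by apply: IHp => //; exact: move_root.
rewrite inE (negPf utp) orbF => /eqP ur _ _.
by rewrite !walk_notin // !ffunE ur eqxx !orbT.
Qed.

Lemma walk_last r g p : g r = r -> walk r g p (last r p) = last r p.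
Proof. by elim: p r g => //= t p IHp r g _; rewrite IHp // move_root. Qed.

(** The last exit from a vertex leads to a vertex whose own last visit is later, so following last
    exits ends at the final vertex. *)
Lemma walk_reach r g p u : g r = r -> u \in r :: p -> fconnect (walk r g p) u (last r p).
Proof.
elim: p r g u => /= [|t p IHp] r g u gr; first by rewrite inE => /eqP->.
have [utp _|utp] := boolP (u \in t :: p).
  by apply: IHp => //; apply: move_root.
rewrite inE (negPf utp) orbF => /eqP ur.
have := IHp t (move r g t) t (move_root r g t) (mem_head _ _).
apply: connect_trans; apply: (connect1 (e := frel _)).
by rewrite /= walk_notin // ffunE ur eqxx orbT.
Qed.

Definition step_or_stay : rel V := fun u v => (u == v) || E u v.

Lemma walk_edge r g p u : g r = r -> path step_or_stay r p -> u \in r :: p ->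
  step_or_stay u (walk r g p u).
Proof.
elim: p r g => /= [|t p IHp] r g gr; first by rewrite inE => _ /eqP->; rewrite gr /step_or_stay eqxx.
case/andP=> rt tp; have [utp _|utp] := boolP (u \in t :: p).
  by apply: IHp => //; exact: move_root.
by rewrite inE (negPf utp) orbF => /eqP ur; rewrite walk_notin // ffunE ur eqxx orbT.
Qed.

(** The orbits of [u] under [f] and [h] agree until they first meet [A]; from there [h] leads to
    [B]. *)
Lemma reach_transfer (f h : V -> V) A B u :
  (forall v, v \notin A -> f v = h v) ->
  (forall v, v \in A -> exists2 r, r \in B & fconnect h v r) ->
  (exists2 r, r \in A & fconnect f u r) -> exists2 r, r \in B & fconnect h u r.
Proof.
move=> fh AB [r rA /fconnectP[k Er]]; elim: k u Er => [|k IHk] u Er.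
  by apply: AB; rewrite -[u]Er.
have [uA|uA] := boolP (u \in A); first exact: AB.
have [|s sB fus] := IHk (f u); first by rewrite -iterSr.
exists s => //; apply: connect_trans fus; rewrite fh //; exact: fconnect1.
Qed.

Lemma fun_forestP U g :
  reflect [/\ forall u, u \in U -> g u = u, forall u, u \notin U -> E u (g u) &
     forall u, exists2 r, r \in U & fconnect g u r] (fun_forest E U g).
Proof.
apply: (iffP andP) => [[/forallP loc /forallP re]|[gU gE re]].
  split=> u => [uU|uU|]; try by [have := loc u; rewrite uU => /eqP|have := loc u; rewrite (negPf uU)].
  by have /existsP[r /andP[]] := re u; exists r.
split; apply/forallP=> u; first by case: ifP => [/gU->|/negbT/gE].
by have [r rU ur] := re u; apply/existsP; exists r; rewrite rU.
Qed.

Definition cut A g : {ffun V -> V} := [ffun u => if u \in A then u else g u].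

Lemma cut_forest A v g : v \in A -> fun_forest E [set v] g -> fun_forest E A (cut A g).
Proof.
move=> vA /fun_forestP[_ gE re]; apply/fun_forestP; split=> [u uA|u uA|u].
- by rewrite ffunE uA.
- by rewrite ffunE (negPf uA) gE // inE; apply: contraNneq uA => ->.
- apply: (@reach_transfer g _ A) => [w wA|w wA|]; first by rewrite ffunE (negPf wA).
    by exists w => //; apply: connect0.
  by have [r] := re u; rewrite inE => /eqP-> ?; exists v.
Qed.

Lemma tree_of_forest A v g h : v \in A -> fun_forest E A g -> h v = v ->
  (forall u, u \notin A -> h u = g u) ->
  (forall u, u \in A -> step_or_stay u (h u) /\ fconnect h u v) ->
  fun_forest E [set v] h.
Proof.
move=> vA /fun_forestP[gA gE re] hv hg hA; apply/fun_forestP; split=> [u|u|u].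
- by rewrite inE => /eqP->.
- rewrite inE => uv; have [uA|uA] := boolP (u \in A); last by rewrite hg // gE.
  (* If [h] fixed [u], then [u] would reach only itself, hence be [v]. *)
  have [/orP[/eqP Eu|//] /fconnectP[k]] := hA u uA.
  by rewrite iter_fixed // => vu; rewrite vu eqxx in uv.
apply: (@reach_transfer g _ A) (re u) => [w wA|w /hA[_ wv]]; first by rewrite hg.
by exists v; rewrite ?inE.
Qed.

(** With [A] the set of visited vertices, [cut A] is a bijection: a fixed tree has on [A] the last
    exits of the walk, whence injectivity, and letting the walk act on a forest yields its
    preimage. *)
Lemma card_walk_fixed v p : p != [::] -> last v p = v -> path step_or_stay v p ->
  #|[set g | fun_forest E [set v] g && (walk v g p == g)]| =
  #|[set g | fun_forest E [set u in p] g]|.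
Proof.
move=> p0 lp pp; set A := [set u in p].
have vp : v \in p by rewrite -{1}lp; case: p p0 {lp pp A} => //= t p _; exact: mem_last.
have vA : v \in A by rewrite inE.
have inA u : (u \in v :: p) = (u \in A) by rewrite !inE; case: eqP => // ->; rewrite vp.
have root_fix g : fun_forest E [set v] g -> g v = v.
  by case/fun_forestP=> gv _ _; apply: gv; rewrite inE.
rewrite -(card_in_imset (f := cut A)) => [|g h]; last first.
  rewrite !inE => /andP[/root_fix gv /eqP Eg] /andP[/root_fix hv /eqP Eh] Ec.
  apply/ffunP=> u; have [uA|uA] := boolP (u \in A).
    by rewrite -Eg -Eh; apply: walk_in; rewrite ?inA.
  by move/ffunP/(_ u): Ec; rewrite !ffunE (negPf uA).
apply: eq_card => g; rewrite inE; apply/imsetP/idP => [[h]|gF].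
  by rewrite inE => /andP[hT _] ->; apply: cut_forest hT.
have gA u : u \in A -> g u = u by case/fun_forestP: gF => gA _ _; apply: gA.
have wv : walk v g p v = v by have := walk_last p (gA v vA); rewrite lp.
exists (walk v g p); last first.
  by apply/ffunP=> u; rewrite ffunE; case: ifP => [/gA//|/negbT uA]; rewrite walk_notin // inA.
rewrite inE; apply/andP; split.
  apply: (tree_of_forest vA gF wv) => u uA; first by rewrite walk_notin // inA.
  split; first by apply: walk_edge; rewrite ?gA // inA.
  by have := @walk_reach v g p u; rewrite lp inA; apply => //; apply: gA.
apply/eqP/ffunP=> u; have [uA|uA] := boolP (u \in A).
  by apply: walk_in; rewrite ?inA ?gA.
by rewrite walk_notin // inA.
Qed.

Lemma walk_connect (A : {set V}) v p u : {subset v :: p <= A} -> path step_or_stay v p ->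
  u \in v :: p -> connect (induced E A) v u /\ connect (induced E A) u (last v p).
Proof.
elim: p v u => /= [|t p IHp] v u sA; first by rewrite inE => _ /eqP->; split; apply: connect0.
case/andP=> vt tp; have vA : v \in A by apply: sA; rewrite mem_head.
have sA' : {subset t :: p <= A} by move=> x xt; apply: sA; rewrite inE xt orbT.
have cvt : connect (induced E A) v t.
  case/orP: vt => [/eqP->|vt]; first exact: connect0.
  by apply: connect1; rewrite /induced vt vA sA' ?mem_head.
rewrite inE => /orP[/eqP->|ut].
  split; first exact: connect0.
  by apply: connect_trans cvt (IHp t t sA' tp (mem_head _ _)).2.
by have [c1 c2] := IHp t u sA' tp ut; split=> //; apply: connect_trans c1.
Qed.

Lemma closed_walk_strongly_connected v p : p != [::] -> last v p = v ->
  path step_or_stay v p -> strongly_connected E [set u in p].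
Proof.
move=> p0 lp pp.
have vp : v \in p by rewrite -{1}lp; case: p p0 {lp pp} => //= t p _; exact: mem_last.
have sub : {subset v :: p <= [set u in p]}.
  by move=> u; rewrite !inE => /orP[/eqP->|].
apply/andP; split; first by apply/set0Pn; exists v; rewrite inE.
apply/forallP=> u; apply/implyP; rewrite inE => up; apply/forallP=> w; apply/implyP; rewrite inE => wp.
have [|_ c1] := @walk_connect _ v p u sub pp; first by rewrite inE up orbT.
have [|c2 _] := @walk_connect _ v p w sub pp; first by rewrite inE wp orbT.
by rewrite lp in c1; apply: connect_trans c2.
Qed.

End WalkFixed.

(** * The exploration algorithm *)

Lemma fconnect_eq_in (T : finType) (f h : T -> T) (S : {set T}) u w :
  (forall x, x \in S -> f x \in S) -> (forall x, x \in S -> f x = h x) ->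
  u \in S -> fconnect f u w -> fconnect h u w.
Proof.
move=> fS fh uS /fconnectP[m ->].
have [-> _] : iter m f u = iter m h u /\ iter m f u \in S.
  by elim: m => //= m [<- IH]; split; [apply: fh | apply: fS].
exact: fconnect_iter.
Qed.

Section Exploring.
Local Open Scope nat_scope.
Variables (V : finType) (E : rel V) (v : V).
Hypothesis irrE : irreflexive E.
Implicit Types (h : {set V * V}) (st : {set V} * {set V * V} * seq (V * V)).
Implicit Types (g a : {ffun V -> V}) (A : {set V}).

Definition run h k := iter k (explore_step h)
  ([set v], [set f : V * V | E f.1 f.2 && (f.1 != v)], [seq (u, v) | u <- enum V & E u v]).

Definition explore_inv st := [/\ {subset st.2 <= st.1.2},
  forall f, f \in st.1.2 -> f.1 \notin st.1.1 /\ E f.1 f.2,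
  forall f, f \in st.2 -> f.2 \in st.1.1 & v \in st.1.1].

Lemma run_inv h k : explore_inv (run h k).
Proof.
elim: k => [|k]; first split=> /= [f|f|f|].
- by case/mapP=> u; rewrite mem_filter => /andP[uv _] -> /=; rewrite inE /= uv; 
    apply: contraTneq uv => ->; rewrite irrE.
- by rewrite !inE => /andP[-> ->].
- by case/mapP=> u _ ->; rewrite inE.
- by rewrite inE.
rewrite /run iterS -/(run h k); case: (run h k) => -[S F] [|e L] //.
move=> /= -[/= LF FS LS vS]; case: ifP => _; split=> /= [f|f|f|] //.
- rewrite mem_cat mem_filter => /orP[/andP[fe fL]|/mapP[u]].
    by rewrite inE LF ?fe // inE fL orbT.
  by rewrite mem_filter => /andP[uF _] ->.
- rewrite inE => /andP[/FS[fS Ef] fe]; split=> //; by rewrite !inE negb_or fe.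
- rewrite mem_cat mem_filter => /orP[/andP[_ fL]|/mapP[u _ ->]]; last by rewrite !inE eqxx.
  by rewrite !inE LS ?orbT // inE fL orbT.
- by rewrite !inE vS orbT.
- by rewrite mem_filter => /andP[fe fL]; rewrite inE fe LF // inE fL orbT.
- by rewrite inE => /andP[/FS].
- by rewrite mem_filter => /andP[_ fL]; rewrite LS // inE fL orbT.
Qed.

Definition steps := #|{: V * V}|.+1.

Lemma phi_run h : phi E h v = (run h steps).1.1.
Proof. by []. Qed.

(** While the list is nonempty, each iteration removes at least its first edge from [F], so the
    number of iterations plus the size of [F] stays bounded by the number of pairs. *)
Lemma run_end h : (run h steps).2 = [::].
Proof.
have H k : (run h k).2 = [::] \/ k + #|(run h k).1.2| <= #|{: V * V}|.
  elim: k => [|k IHk]; first by right; rewrite add0n; apply: max_card.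
  rewrite /run iterS -/(run h k); have [] := run_inv h k.
  case: (run h k) IHk => -[S F] [|e L] /=; first by left.
  case=> // lek LF _ _ _; right; have eF : e \in F by apply: LF; rewrite mem_head.
  rewrite addSn; apply: leq_trans lek; rewrite ltn_add2l; apply: proper_card.
  by case: ifP => _; apply/properP; split;
     try (by apply/subsetP=> f; rewrite inE => /andP[]); exists e; rewrite // inE eqxx ?andbF.
by have [|] := H steps; rewrite // /steps addSn ltnNge leq_addr.
Qed.

Lemma run_sub h j k : j <= k -> (run h j).1.1 \subset (run h k).1.1.
Proof.
move/subnKC <-; elim: (k - j)%N => [|m IHm]; first by rewrite addn0.
apply: subset_trans IHm _; rewrite addnS /run iterS -/(run h _).
by case: (run h _) => -[S F] [|e L] //=; case: ifP => //= _; rewrite subsetU1.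
Qed.

(** Rejecting [e] removes from [F] every edge with source [e.1], and a vertex is accepted only
    through an edge that is still in [F]. *)
Lemma run_reject h j k e L : (run h j).2 = e :: L -> e \notin h -> j <= k ->
  e.1 \notin (run h k).1.1.
Proof.
move=> Ej eh; case: ltngtP => // [ltjk _|<- _]; last first.
  have [LF FS _ _] := run_inv h j; have [] := FS e => //.
  by apply: LF; rewrite Ej mem_head.
have H m : e.1 \notin (run h (j.+1 + m)).1.1 /\
    forall f, f \in (run h (j.+1 + m)).1.2 -> f.1 != e.1.
  elim: m => [|m [IH1 IH2]].
    have [LF FS _ _] := run_inv h j.
    rewrite addn0 /run iterS -/(run h j); case: (run h j) Ej LF FS => -[S F] L' /= ->.
    move=> LF FS; rewrite (negPf eh) /=; split=> [|f].
      by have [] := FS e => //; apply: LF; rewrite mem_head.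
    by rewrite inE => /and3P[].
  rewrite addnS /run iterS -/(run h _); have [LF _ _ _] := run_inv h (j.+1 + m).
  case: (run h _) IH1 IH2 LF => -[S F] [|d L'] //= IH1 IH2 LF.
  case: ifP => _ /=; (split; last by move=> f; rewrite inE => /andP[/IH2]) => //.
  rewrite !inE negb_or IH1 andbT eq_sym; apply: IH2; apply: LF; exact: mem_head.

by rewrite -(subnKC ltjk); case: (H (k - j.+1)%N).
Qed.

(* [p] sends each vertex accepted before step [k] to the target of the edge that got it accepted. *)
Lemma accept_parent h k : exists p : V -> V,
  [/\ p v = v,
      forall u, u \in (run h k).1.1 -> p u \in (run h k).1.1 /\ fconnect p u v,
      forall u, u \in (run h k).1.1 -> u != v ->
        exists2 j, j < k & ohead (run h j).2 = Some (u, p u) /\ (u, p u) \in h &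
      forall j e, j < k -> ohead (run h j).2 = Some e -> e \in h -> p e.1 = e.2].
Proof.
elim: k => [|k [p [pv pS pj jp]]].
  exists id; split=> // u /=; rewrite inE => /eqP->; rewrite ?inE ?eqxx //.
have [LF FS LS vS] := run_inv h k.
have Erun : run h k.+1 = explore_step h (run h k) by [].
case El: (run h k).2 => [|e L].
  have E' : run h k.+1 = run h k by rewrite Erun; case: (run h k) El => -[S F] L /= ->.
  exists p; rewrite E'; split=> // [u uS uv|j e].
    by have [j ltjk H] := pj u uS uv; exists j => //; apply: leqW.
  by rewrite ltnS leq_eqVlt => /orP[/eqP->|]; [rewrite El|apply: jp].
have eL : e \in (run h k).2 by rewrite El mem_head.
have [eS _] := FS e (LF e eL); have e2S := LS e eL.
case eh: (e \in h); last first.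
  have E' : (run h k.+1).1.1 = (run h k).1.1.
    by rewrite Erun; case: (run h k) El => -[S F] L' /= ->; rewrite eh.
  exists p; rewrite E'; split=> // [u uS uv|j f].
    by have [j ltjk H] := pj u uS uv; exists j => //; apply: leqW.
  rewrite ltnS leq_eqVlt => /orP[/eqP->|]; last exact: jp.
  by rewrite El => -[<-]; rewrite eh.
have E' : (run h k.+1).1.1 = e.1 |: (run h k).1.1.
  by rewrite Erun; case: (run h k) El => -[S F] L' /= ->; rewrite eh.
(* The map changes only at the newly accepted vertex, which no earlier chain to [v] visits. *)
pose p' u := if u == e.1 then e.2 else p u.
have pp u : u \in (run h k).1.1 -> p' u = p u.
  by rewrite /p'; case: eqP => // ->; rewrite (negPf eS).
have cn u : u \in (run h k).1.1 -> fconnect p' u v.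
  move=> uS; apply: (fconnect_eq_in (f := p) (S := (run h k).1.1)) => // [x xS|x /pp//|].
    by case: (pS _ xS).
  by case: (pS _ uS).
exists p'; rewrite E'; split=> [|u|u|j f].
- by rewrite pp.
- rewrite !inE => /orP[/eqP->|uS].
    rewrite {1 2}/p' eqxx e2S orbT; split=> //.
    apply: connect_trans (cn _ e2S); apply: (connect1 (e := frel _)).
    by rewrite /= /p' eqxx.
  by split; [rewrite pp //; have [-> _] := pS u uS; rewrite orbT | apply: cn].
- rewrite !inE => /orP[/eqP-> _|uS uv].
    by exists k => //; rewrite El /p' eqxx -surjective_pairing.
  by rewrite pp //; have [j ltjk H] := pj u uS uv; exists j => //; apply: leqW.
rewrite ltnS leq_eqVlt => /orP[/eqP->|ltjk Hj fh].
  by rewrite El => -[<-] _; rewrite /p' eqxx.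
rewrite -(jp j f) // pp //; have := run_sub h ltjk; move/subsetP; apply.
by rewrite /run iterS -/(run h j); case: (run h j) Hj => -[S F] [|d L'] //= [->]; 
  rewrite fh !inE eqxx.
Qed.

(** The set [h] enters the exploration only through the test on the head of the list, so agreement
    on the examined edges suffices. *)
Lemma run_agree h h' K :
  (forall k e, k < K -> run h k = run h' k -> ohead (run h' k).2 = Some e ->
     (e \in h) = (e \in h')) ->
  forall k, k <= K -> run h k = run h' k.
Proof.
move=> H; elim=> // k IHk ltk; have Ek := IHk (ltnW ltk).
rewrite /run !iterS -/(run h k) -/(run h' k) Ek; have := H k _ ltk Ek.
by case: (run h' k) => -[S F] [|e L] //= /(_ e erefl) ->.
Qed.

End Exploring.

(** * Multiplicities and the counting of forests *)

Section Multiplicities.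
Local Open Scope nat_scope.
Variables (V : finType) (E : rel V).
Hypothesis irrE : irreflexive E.
Implicit Types (g a : {ffun V -> V}) (A W : {set V}) (u v : V).

(* Exploring with all the edges out of [A] declared accepted. *)
Definition open_edges A g : {set V * V} := [set f | (f.1 \in A) || (f \in fun_edges g)].

Definition forest_count A := #|[set g | fun_forest E A g]|.

(** No edge with source in [A] is rejected. So an edge inside [A] survives while its source is
    unaccepted, and is in the list once its target is accepted. The list ends empty, hence
    acceptance propagates backwards along the paths of [A] that lead to [v]. *)
Lemma sub_phi_open_edges A v g : strongly_connected E A -> v \in A ->
  A \subset phi E (open_edges A g) v.
Proof.
case/andP=> _ /forallP sc vA; rewrite phi_run; set h := open_edges A g.
have H k u w : u \in A -> w \in A -> E u w -> u \notin (run E v h k).1.1 ->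
    (u, w) \in (run E v h k).1.2 /\ (w \in (run E v h k).1.1 -> (u, w) \in (run E v h k).2).
  move=> uA wA uw; elim: k => [|k].
    rewrite /= !inE => uv; rewrite uw uv; split=> // /eqP wv.
    by apply/mapP; exists u; rewrite ?wv // mem_filter mem_enum -wv uw.
  rewrite /run iterS -/(run E v h k); have [LF FS _ _] := run_inv v irrE h k.
  case: (run E v h k) LF FS => -[S F] [|e L] //= LF FS IH.
  case: ifP => [eh|/negbT eh] /=.
    rewrite !inE negb_or => /andP[ue uS]; have [uwF uwL] := IH uS.
    rewrite uwF ue; split=> // /orP[/eqP we|wS]; rewrite mem_cat mem_filter /= ue /=.
      rewrite we in uwF; apply/orP; right; apply/mapP; exists u; rewrite ?we //.
      by rewrite mem_filter mem_enum inE /= uwF ue.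
    have := uwL wS; rewrite inE => /orP[/eqP Ee|-> //].
    by rewrite -Ee eqxx in ue.
  have [ue we] : u != e.1 /\ w != e.1.
    by split; apply: contraNneq eh => E1; rewrite inE -E1 ?uA ?wA.
  move=> uS; have [uwF uwL] := IH uS; rewrite inE uwF /= ue we; split=> // /uwL.
  rewrite inE mem_filter /= ue we /= => /orP[/eqP Ee|//].
  by rewrite -Ee eqxx in ue.
apply/subsetP=> u uA; have /forallP/(_ v) := implyP (sc u) uA; rewrite vA /=.
case/connectP=> p; elim: p u uA => /= [|w p IHp] u uA.
  by move=> _ <-; have [] := run_inv v irrE h (steps V).
case/andP=> /and3P[uw _ wA] wp /(IHp w wA wp) wS.
apply: contraT => uS; have [_ /(_ wS)] := H (steps V) u w uA wA uw uS.
by rewrite run_end.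
Qed.

Lemma fun_edges_cut A a e : e.1 \notin A ->
  (e \in fun_edges a) = (e \in open_edges A (cut A a)).
Proof. by move=> eA; rewrite !inE (negPf eA) /= ffunE (negPf eA). Qed.

(** An examined edge with source in [A] belongs to [a], since its rejection would keep the source
    out of the explored set. Declaring it accepted thus changes nothing. *)
Lemma run_cut A v a : A \subset phi E (fun_edges a) v ->
  forall k, k <= steps V -> run E v (fun_edges a) k = run E v (open_edges A (cut A a)) k.
Proof.
rewrite phi_run => /subsetP sA; apply: run_agree => k e ltk Ek.
have [eA|eA] := boolP (e.1 \in A); last by rewrite (fun_edges_cut _ eA).
rewrite -Ek => He; rewrite !inE eA /=; apply: contraTT (sA _ eA) => eh.
case L: (run E v (fun_edges a) k).2 He => [|d L'] // [Ed]; rewrite Ed in L.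
by apply: (run_reject irrE L); rewrite ?(ltnW ltk) // inE.
Qed.

Lemma run_head_cut A v a k e : A \subset phi E (fun_edges a) v -> k < steps V ->
  ohead (run E v (open_edges A (cut A a)) k).2 = Some e -> e.1 \in A -> e \in fun_edges a.
Proof.
move=> sA ltk; have := run_cut sA (ltnW ltk); move/subsetP: sA; rewrite phi_run => sA <-.
case L: (run E v (fun_edges a) k).2 => [|d L'] // [Ed] eA; rewrite Ed in L.
apply: contraTT (sA _ eA) => eh.
by apply: (run_reject irrE L); rewrite ?(ltnW ltk).
Qed.

(** [cut A] is a bijection. For injectivity, the exploration with [A] open depends only on the cut
    forest, and the edge by which it accepts a vertex of [A] must lie in both trees. *)
Lemma card_explored A v : strongly_connected E A -> v \in A ->
  #|[set a | fun_forest E [set v] a && (A \subset phi E (fun_edges a) v)]| = forest_count A.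
Proof.
move=> scA vA; rewrite -(card_in_imset (f := cut A)) => [|a b]; last first.
  rewrite !inE => /andP[aT sa] /andP[bT sb] Ecut; apply/ffunP=> u.
  have [uA|uA] := boolP (u \in A); last by move/ffunP/(_ u): Ecut; rewrite !ffunE (negPf uA).
  have rt c : fun_forest E [set v] c -> c v = v.
    by case/fun_forestP=> cv _ _; apply: cv; rewrite inE.
  have [->|uv] := eqVneq u v; first by rewrite !rt.
  have [p [_ _ pj _]] := accept_parent v irrE (open_edges A (cut A a)) (steps V).
  have [|j ltj [Hj _]] := pj u _ uv.
    by rewrite -phi_run; apply: (subsetP (sub_phi_open_edges _ scA vA)).
  have := run_head_cut sa ltj Hj uA; rewrite Ecut in Hj.
  have := run_head_cut sb ltj Hj uA.
  by rewrite !inE /= => /andP[/eqP-> _] /andP[/eqP-> _].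
rewrite /forest_count; apply: eq_card => g; rewrite [RHS]inE; apply/imsetP/idP => [[a]|gF].
  by rewrite inE => /andP[aT _] ->; apply: cut_forest aT.
have gA u : u \in A -> g u = u by case/fun_forestP: gF => gA _ _; apply: gA.
set h := open_edges A g.
have [p [pv pS pj jp]] := accept_parent v irrE h (steps V).
have sA := subsetP (sub_phi_open_edges g scA vA); rewrite phi_run -/h in sA.
(* The preimage of [g] sends each vertex of [A] other than [v] along the edge that got it accepted
   in the exploration with [A] open. *)
pose a := [ffun u => if u \in A then p u else g u].
have ap u : u \in (run E v h (steps V)).1.1 -> p u = a u.
  move=> uS; rewrite ffunE; case: ifP => // uA.
  have uv : u != v by apply: contraFneq uA => ->.
  have [j _ [_]] := pj u uS uv; rewrite inE uA /= inE /=.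
  by case/andP=> /eqP.
have cA : cut A a = g.
  by apply/ffunP=> u; rewrite /cut /a !ffunE; case uA: (u \in A) => //; rewrite gA.
exists a => //; rewrite inE; apply/andP; split.
  apply: (tree_of_forest vA gF) => [|u uA|u uA]; first by rewrite -ap // sA.
    by rewrite ffunE (negPf uA).
  split.
    rewrite /step_or_stay -ap ?sA //; have [->|uv] := eqVneq u v; first by rewrite pv eqxx.
    have [j ltj [Hj _]] := pj u (sA u uA) uv; have [LF FS _ _] := run_inv v irrE h j.
    have [|_ ->] := FS (u, p u); last by rewrite orbT.
    by apply: LF; case: (run E v h j).2 Hj => //= e L [->]; rewrite mem_head.
  apply: (fconnect_eq_in (f := p) (S := (run E v h (steps V)).1.1)) => //; try exact: sA.
    by move=> x /pS[].
  by have [] := pS u (sA u uA).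
rewrite phi_run (@run_agree _ _ _ (fun_edges a) h (steps V)) //; first by apply/subsetP.
(* An examined edge with source in [A] is open, so by [jp] it follows [p] and belongs to [a]. *)
move=> k e ltk _ He; have [eA|eA] := boolP (e.1 \in A); last by rewrite /h -cA -fun_edges_cut.
have eh : e \in h by rewrite inE eA.
rewrite eh inE -ap ?sA // (jp k e) // eqxx /=; apply/eqP => E12.
have [LF FS _ _] := run_inv v irrE h k.
have [|_] := FS e; last by rewrite E12 irrE.
by apply: LF; case: (run E v h k).2 He => //= d L [->]; rewrite mem_head.
Qed.

Lemma connect_induced_sub A W u w : A \subset W ->
  connect (induced E A) u w -> connect (induced E W) u w.
Proof.
move/subsetP=> AW; apply: connect_sub u w => u w /and3P[uw uA wA].
by apply: connect1; rewrite /induced uw !AW.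
Qed.

Lemma scc_strongly_connected W v : v \in W -> strongly_connected E (scc_in E W v).
Proof.
move=> vW; set C := scc_in E W v.
have vC : v \in C by rewrite inE vW !connect0.
apply/andP; split; first by apply/set0Pn; exists v.
apply/forallP=> u; apply/implyP=> uC; apply/forallP=> w; apply/implyP=> wC.
have : connect (induced E W) u w.
  move: uC wC; rewrite !inE => /and3P[_ _ uv] /and3P[_ vw _].
  exact: connect_trans vw.
case/connectP=> p; elim: p u uC => /= [|t p IHp] u uC; first by move=> _ ->; apply: connect0.
case/andP=> ut tp Ew; have cut : connect (induced E W) u t := connect1 ut.
have ctw : connect (induced E W) t w by apply/connectP; exists p.
have tC : t \in C.
  move: uC wC ut; rewrite !inE => /and3P[_ vu _] /and3P[_ _ wv] /and3P[_ _ ->] /=.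
  by rewrite (connect_trans vu cut) (connect_trans ctw wv).
by apply: connect_trans (IHp t tC tp Ew); apply: connect1; case/and3P: ut => ut _ _; apply/and3P.
Qed.

Lemma sub_scc A W v : strongly_connected E A -> v \in A -> v \in W ->
  (A \subset scc_in E W v) = (A \subset W).
Proof.
case/andP=> _ /forallP sc vA vW; apply/idP/idP => AW.
  by apply: subset_trans AW _; apply/subsetP=> u; rewrite inE => /andP[].
apply/subsetP=> u uA; rewrite inE (subsetP AW) //=; apply/andP.
have /forallP/(_ u) := implyP (sc v) vA; rewrite uA /= => c1.
have /forallP/(_ v) := implyP (sc u) uA; rewrite vA /= => c2.
by split; apply: connect_induced_sub AW _.
Qed.

Lemma mem_phi h v : v \in phi E h v.
Proof. by rewrite phi_run; have [] := run_inv v irrE h (steps V). Qed.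

Lemma mult_fun W v :
  mult E W v = #|[set a | fun_forest E [set v] a && (psi E (fun_edges a) v == W)]|.
Proof.
rewrite /mult -[RHS](card_imset _ (can_inj (@fun_edgesK V))); apply: eq_card => T.
rewrite inE rooted_treeE; apply/andP/imsetP => [[Tv pT]|[a]].
  exists (parent_fun T); last by rewrite (parent_funK irrE Tv).
  by rewrite inE -rooted_forest_fun_edges // (parent_funK irrE Tv) Tv.
by rewrite inE => /andP[aT pa] ->; rewrite rooted_forest_fun_edges.
Qed.

(** The trees are sorted by the value of [psi]; by [sub_scc] this set contains [A] exactly when
    [phi] does. *)
Lemma sum_mult A v : strongly_connected E A -> v \in A ->
  \sum_(W : {set V} | strongly_connected E W && (A \subset W)) mult E W v = forest_count A.
Proof.
move=> scA vA; rewrite -(card_explored scA vA).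
rewrite -sum1_card (partition_big (fun a : {ffun V -> V} => psi E (fun_edges a) v)
  (fun W => strongly_connected E W && (A \subset W))) /= => [|a]; last first.
  rewrite inE => /andP[_ sA]; rewrite scc_strongly_connected ?mem_phi //.
  by rewrite sub_scc ?mem_phi.
apply: eq_bigr => W /andP[scW sAW]; rewrite mult_fun -sum1_card; apply: eq_bigl => a.
rewrite !inE; case: eqP => [Ea|]; last by rewrite !andbF.
by rewrite !andbT -(sub_scc scA vA) ?mem_phi // -/(psi _ _ _) Ea sAW andbT.
Qed.

(** In [sum_mult] for [A = W] the total does not depend on the vertex. By induction on the size of
    the complement, neither do the terms of the proper supersets of [W], so the term of [W] does not
    either. *)
Lemma mult_indep W u v : strongly_connected E W -> u \in W -> v \in W ->
  mult E W u = mult E W v.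
Proof.
have [m] := ubnP (#|V| - #|W|); elim: m W => // m IHm W ltm scW uW vW.
have := sum_mult scW uW; rewrite -(sum_mult scW vW).
rewrite (bigD1 W) ?scW ?subxx //= [in X in _ = X](bigD1 W) ?scW ?subxx //=.
rewrite (@eq_bigr _ _ _ _ _ _ (fun W' => mult E W' u) (fun W' => mult E W' v)).
  by move/addIn.
move=> W' /andP[/andP[scW' sWW'] nW]; have lt : #|W| < #|W'|.
  by apply: proper_card; rewrite properEneq eq_sym nW.
apply: IHm => //; try exact: (subsetP sWW').
apply: (@leq_trans (#|V| - #|W|)) => //; apply: ltn_sub2l => //.
exact: leq_trans lt (max_card _).
Qed.

Lemma mW_mult W v : strongly_connected E W -> v \in W -> mW E W = mult E W v.
Proof.
move=> scW vW; rewrite /mW; case: pickP => [u uW|/(_ v)]; first exact: mult_indep.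
by rewrite vW.
Qed.

Lemma sum_mW A : strongly_connected E A ->
  \sum_(W : {set V} | strongly_connected E W && (A \subset W)) mW E W = forest_count A.
Proof.
move=> scA; have /set0Pn[v vA] : A != set0 by case/andP: scA.
rewrite -(sum_mult scA vA); apply: eq_bigr => W /andP[scW sAW].
by apply: mW_mult; rewrite ?(subsetP sAW).
Qed.

(** For [A = V] the sum has one term, and the only forest in which every vertex is a root has no
    edges. *)
Lemma mW_setT : strongly_connected E setT -> mW E setT = 1.
Proof.
move=> scT; have := sum_mW scT; rewrite (big_pred1 setT) => [->|W]; last first.
  by rewrite subTset /=; case: eqP => [->|]; rewrite ?scT ?andbF.
rewrite /forest_count (_ : [set g | _] = [set [ffun u => u]]) ?cards1 //.
apply/setP=> g; rewrite !inE; apply/fun_forestP/eqP => [[gT _ _]|->].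
  by apply/ffunP=> u; rewrite ffunE gT.
split=> u; rewrite ?inE ?ffunE //; exists u; rewrite ?inE //; exact: connect0.
Qed.

End Multiplicities.

(** * The determinant of the tree graph *)

Section TreeGraphWalks.
Variables (V : finType) (E : rel V).
Hypothesis irrE : irreflexive E.
Implicit Types (a b : TGvert E) (t v : V).

Definition tree_fun a := parent_fun (val a).

Definition tree_root a : V := xchoose (existsP (valP a)).

(** [insubd] takes a default value, here [a]; by [val_tree_step] it never matters when [t] is the
    root or the target of an edge from the root. *)
Definition tree_step a t : TGvert E := insubd a (fun_edges (move (tree_root a) (tree_fun a) t)).

Lemma tree_rootP a : rooted_tree E (val a) (tree_root a).
Proof. exact: xchooseP. Qed.

Lemma tree_funK a : fun_edges (tree_fun a) = val a.
Proof. by apply: (@parent_funK _ E _ [set tree_root a]) => //; rewrite -rooted_treeE tree_rootP. Qed.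

Lemma tree_funP a : fun_forest E [set tree_root a] (tree_fun a).
Proof. by rewrite -rooted_forest_fun_edges // tree_funK -rooted_treeE tree_rootP. Qed.

Lemma tree_fun_root a : tree_fun a (tree_root a) = tree_root a.
Proof. by case/fun_forestP: (tree_funP a) => gU _ _; apply: gU; rewrite inE. Qed.

Lemma spanning_tree_fun_edges v g : fun_forest E [set v] g -> spanning_tree E (fun_edges g).
Proof.
by move=> F; apply/existsP; exists v; rewrite rooted_treeE rooted_forest_fun_edges.
Qed.

Lemma move_tree r t g : step_or_stay E r t -> fun_forest E [set r] g ->
  fun_forest E [set t] (move r g t).
Proof.
move=> rt gT; have rA : r \in [set r; t] by rewrite !inE eqxx.
apply: (tree_of_forest _ (cut_forest rA gT)) => [||u uA|u].
- by rewrite !inE eqxx orbT.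
- exact: move_root.
- by rewrite !ffunE (negPf uA); move: uA; rewrite !inE orbC => /negPf->.
rewrite !inE => /orP[/eqP->|/eqP->].
  rewrite ffunE eqxx orbT; split=> //; apply: (connect1 (e := frel _)).
  by rewrite /= ffunE eqxx orbT.
by rewrite move_root /step_or_stay eqxx connect0.
Qed.

Lemma val_tree_step a t : step_or_stay E (tree_root a) t ->
  val (tree_step a t) = fun_edges (move (tree_root a) (tree_fun a) t).
Proof.
move=> rt; rewrite /tree_step val_insubd (@spanning_tree_fun_edges t) //.
exact: move_tree (tree_funP a).
Qed.

Lemma tree_fun_step a t : step_or_stay E (tree_root a) t ->
  tree_fun (tree_step a t) = move (tree_root a) (tree_fun a) t.
Proof. by move=> rt; rewrite /tree_fun val_tree_step // fun_edgesK. Qed.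

Lemma tree_root_step a t : step_or_stay E (tree_root a) t -> tree_root (tree_step a t) = t.
Proof.
move=> rt; apply: rooted_tree_root_uniq (tree_rootP _) _; rewrite val_tree_step //.
by rewrite rooted_treeE rooted_forest_fun_edges // move_tree // tree_funP.
Qed.

Lemma tree_fun_inj : injective tree_fun.
Proof. by move=> a b Eab; apply: val_inj; rewrite -!tree_funK Eab. Qed.

Lemma tree_walk a p : path (step_or_stay E) (tree_root a) p ->
  tree_fun (foldl tree_step a p) = walk (tree_root a) (tree_fun a) p /\
  tree_root (foldl tree_step a p) = last (tree_root a) p.
Proof.
elim: p a => //= t p IHp a /andP[rt tp]; have := IHp (tree_step a t).
by rewrite tree_root_step // tree_fun_step // => /(_ tp).
Qed.

Lemma card_tree_walk v p : path (step_or_stay E) v p ->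
  #|[set a | (tree_root a == v) && (foldl tree_step a p == a)]| =
  #|[set g | fun_forest E [set v] g && (walk v g p == g)]|.
Proof.
move=> pp; rewrite -(card_imset _ tree_fun_inj); apply: eq_card => g.
rewrite [RHS]inE; apply/imsetP/andP => [[a]|[gT /eqP gw]].
  rewrite inE => /andP[/eqP ra /eqP Ea] ->; rewrite -ra in pp *.
  by rewrite tree_funP; have [<- _] := tree_walk pp; rewrite Ea.
pose a : TGvert E := Sub (fun_edges g) (spanning_tree_fun_edges gT).
have fa : tree_fun a = g by rewrite /tree_fun SubK fun_edgesK.
have ra : tree_root a = v.
  by apply: rooted_tree_root_uniq (tree_rootP a) _; rewrite SubK rooted_treeE rooted_forest_fun_edges.
exists a => //; rewrite inE ra eqxx /= -(inj_eq tree_fun_inj).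
by have := @tree_walk a p; rewrite ra => /(_ pp) [-> _]; rewrite fa gw.
Qed.

End TreeGraphWalks.

Section DetTreeGraph.
Variables (V : finType) (E : rel V) (R : comNzRingType) (M : V -> V -> R).
Hypothesis irrE : irreflexive E.
Hypothesis ME : forall u t, M u t != 0 -> step_or_stay E u t.

Definition restrict_rows (W : {set V}) u t : R := if u \in W then M u t else 0.

Lemma walk_weight_path v p : walk_weight M v p != 0 -> path (step_or_stay E) v p.
Proof.
elim: p v => //= t p IHp v nz; apply/andP; split.
  by apply: ME; apply: contraNneq nz => ->; rewrite mul0r.
by apply: IHp; apply: contraNneq nz => ->; rewrite mulr0.
Qed.

(** A walk uses the rows of all its vertices but the last, hence [belast]. *)
Lemma walk_weight_restrict W v p : walk_weight (restrict_rows W) v p =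
  if all (mem W) (belast v p) then walk_weight M v p else 0.
Proof.
elim: p v => //= t p IHp v; rewrite IHp /restrict_rows.
by case: ifP => /= _; case: ifP => _; rewrite ?mul0r ?mulr0.
Qed.

Lemma closed_walk_sub (W : {set V}) v p : p != [::] -> last v p = v ->
  all (mem W) (belast v p) = ([set u in p] \subset W).
Proof.
move=> p0 lp; have mb u : (u \in p) = (u \in belast v p).
  have := mem_rcons (belast v p) (last v p) u; rewrite -lastI !inE lp.
  case: eqP => [->|] //= _; case: p p0 lp => //= t p _ <-.
  by rewrite mem_last mem_head.
apply/allP/subsetP => H u; first by rewrite inE mb => /H.
by rewrite -mb => up; apply: H; rewrite inE.
Qed.

Lemma foldl_snd v p : foldl (fun _ t : V => t) v p = last v p.
Proof. by elim: p v => //=. Qed.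

(** For a closed walk of nonzero weight, the fixed trees are as many as the forests rooted in the
    visited set, that is the sum of [mW E W] over the strongly connected [W] containing this set.
    These are the [W] whose restriction keeps the weight. *)
Lemma closed_walk_count v p : p != [::] ->
  walk_weight M v p * (#|[set a | (tree_root a == v) && (foldl (@tree_step V E) a p == a)]|)%:R =
  \sum_(W : {set V} | strongly_connected E W)
    (walk_weight (restrict_rows W) v p * (last v p == v)%:R) *+ mW E W.
Proof.
move=> p0; have [w0|wN0] := eqVneq (walk_weight M v p) 0.
  by rewrite w0 mul0r big1 // => W _; rewrite walk_weight_restrict w0 if_same mul0r mul0rn.
have pp := walk_weight_path wN0.
have [lp|lp] := eqVneq (last v p) v; last first.
  (* A walk moves the root of a tree to its last vertex, so a walk that is not closed fixes no
     tree. *)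
  rewrite [X in _ * X](_ : _ = 0) ?mulr0; last first.
    apply/eqP; rewrite (_ : [set a | _] = set0) ?cards0 //; apply/setP=> a; rewrite !inE.
    apply/negbTE/negP => /andP[/eqP ra /eqP Ea]; rewrite -ra in pp lp.
    by have [_] := tree_walk irrE pp; rewrite Ea => E1; rewrite -E1 eqxx in lp.
  by rewrite big1 // => W _; rewrite mulr0 mul0rn.
rewrite card_tree_walk // card_walk_fixed // -/(forest_count _ _).
rewrite -sum_mW //; last exact: closed_walk_strongly_connected lp pp.
rewrite natr_sum mulr_sumr big_mkcondr /=; apply: eq_bigr => W _.
rewrite walk_weight_restrict closed_walk_sub // mulr1.
by case: ifP => _; rewrite ?mul0rn // mulr_natr.
Qed.

Lemma det_tree_graph : (forall n (z : R), z *+ n.+1 = 0 -> z = 0) ->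
  \det (1%:M - lift_mx (@tree_root V E) (@tree_step V E) M) =
  \prod_(W : {set V} | strongly_connected E W)
     \det (1%:M - lift_mx id (fun _ t => t) (restrict_rows W)) ^+ mW E W.
Proof.
move=> tf; apply: det_eq_prod_of_traces => // n.
rewrite trace_lift_mxX; last by move=> a t /ME; apply: tree_root_step.
under [RHS]eq_bigr do rewrite trace_lift_mxX // -sumrMnl.
rewrite [RHS]exchange_big /=; apply: eq_big_seq => p pw.
have p0 : p != [::] by case/allpairsP: pw => -[t q] [_ _ ->].
under [RHS]eq_bigr do rewrite -sumrMnl.
rewrite [RHS]exchange_big /= (partition_big (@tree_root V E) xpredT) //=.
apply: eq_bigr => v _; under [RHS]eq_bigr do rewrite foldl_snd.
rewrite -closed_walk_count // -sum1_card natr_sum mulr_sumr [RHS]big_mkcond [LHS]big_mkcond.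
apply: eq_bigr => a _; rewrite inE; case: eqP => [->|] //=.
by case: ifP => _; rewrite ?mulr0.
Qed.

End DetTreeGraph.

(** * Characteristic polynomials of Laplacians *)

Section CharPolyLaplacian.
Variables (X : finType) (R : comNzRingType) (ed : rel X) (w : X -> X -> R).
Hypothesis irr : irreflexive ed.
Hypothesis w0 : forall u v, ~~ ed u v -> w u v = 0.

Definition char_laplacian : {poly R} :=
  \det ('X%:M + map_mx polyC (laplacian w set0)).

(** The matrix forest theorem without roots: there is no such forest as soon as there is a vertex
    [u]. *)
Lemma char_laplacian_coef0 (u : X) : char_laplacian`_0 = 0.
Proof.
rewrite -horner_coef0 -horner_evalE -det_map_mx.
have -> : map_mx (horner_eval 0) ('X%:M + map_mx polyC (laplacian w set0)) = laplacian w set0.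
  by apply/matrixP=> i j; rewrite !mxE /= horner_evalE !hornerE hornerMn hornerX mul0rn add0r.
rewrite (matrix_forest _ irr w0) big_pred0 // => g; apply/fun_forestP => -[_ _ /(_ u)[r]].
by rewrite inE.
Qed.

(** Differentiating row [i] turns it into a row of the identity, and at 0 the matrix becomes the
    Laplacian with single root [i]. *)
Lemma char_laplacian_coef1 : char_laplacian`_1 = Ftree ed w.
Proof.
rewrite -[_`_1]mulr1n -coef_deriv -horner_coef0 deriv_det horner_sum Ftree_sum_Psi.
rewrite [RHS](reindex_onto enum_val enum_rank) => [|u _]; last by rewrite enum_rankK.
apply: eq_big => i; rewrite ?enum_valK ?eqxx // => _.
rewrite (Psi_det _ irr w0) -horner_evalE -det_map_mx; congr (\det _).
apply/matrixP=> k l; rewrite !mxE !inE !(inj_eq enum_val_inj) /=.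
case: (k =P i) => [->|_]; rewrite horner_evalE ?derivD ?derivMn ?derivX ?derivC !hornerE ?hornerMn ?hornerX.
  by rewrite hornerC.
by rewrite mul0rn; congr (_ - _); apply: add0r.
Qed.

End CharPolyLaplacian.

Lemma fun_edges_move (V : finType) (g : {ffun V -> V}) r t : g r = r -> r != t ->
  fun_edges (move r g t) =
  (fun_edges g :\: [set f in fun_edges g | f.1 == t]) :|: [set (r, t)].
Proof.
move=> gr rt; apply/setP=> -[u v]; rewrite !inE /= ffunE xpair_eqE.
have [->|ut] := eqVneq u t.
  by rewrite /= andbN andbT andNb [t == r]eq_sym (negPf rt).
rewrite andbF /=; have [->|ur] := eqVneq u r; last by rewrite orbF.
by rewrite gr andbN /= eq_sym; case: eqP => // ->.
Qed.

(** * The factorization over a torsion-free ring *)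

Section TreeGraphFactorization.
Variables (V : finType) (E : rel V) (R : comNzRingType) (x : V -> V -> R).
Hypothesis irrE : irreflexive E.
Hypothesis x0 : forall u v, ~~ E u v -> x u v = 0.
Implicit Types a b : TGvert E.

Lemma tg_stepE a b e : tg_step E (val a) e (val b) =
  [&& E e.1 e.2, e.1 == tree_root a & tree_step a e.2 == b].
Proof.
case: e => r t; rewrite /tg_step /=; case rt: (E r t) => //=.
have -> : rooted_tree E (val a) r = (r == tree_root a).
  apply/idP/eqP => [H|->]; last exact: tree_rootP.
  exact: rooted_tree_root_uniq H (tree_rootP a).
case: eqP => //= Er; rewrite Er in rt *; have st : step_or_stay E (tree_root a) t by rewrite /step_or_stay rt orbT.
rewrite -[RHS]val_eqE val_tree_step // eq_sym; congr (_ == _).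
have rtN : tree_root a != t by apply: contraTneq rt => ->; rewrite irrE.
by rewrite fun_edges_move ?tree_fun_root // tree_funK.
Qed.

Lemma TGrel_irr : irreflexive (@TGrel V E).
Proof.
move=> a; apply/existsP => -[e]; rewrite tg_stepE => /and3P[rt /eqP re /eqP Ea].
have := congr1 (@tree_root V E) Ea; rewrite tree_root_step // -?re; last first.
  by rewrite /step_or_stay rt orbT.
by move=> E12; rewrite E12 irrE in rt.
Qed.

Lemma TGweight0 a b : ~~ TGrel a b -> TGweight x a b = 0.
Proof.
move=> nab; rewrite /TGweight big_pred0 // => e; apply: contraNF nab => H.
by apply/existsP; exists e.
Qed.

Lemma TGweightE a b :
  TGweight x a b = \sum_t x (tree_root a) t * (tree_step a t == b)%:R.
Proof.
rewrite /TGweight; under eq_bigl do rewrite tg_stepE.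
rewrite (reindex_onto (fun t => (tree_root a, t)) snd) /=; last first.
  by case=> r t /= /and3P[_ /eqP-> _].
rewrite big_mkcond; apply: eq_bigr => t _; rewrite !eqxx andbT /=.
case rt: (E _ t) => /=; last by rewrite x0 ?rt // mul0r.
by case: eqP; rewrite ?mulr1 ?mulr0.
Qed.

(** Every edge out of the root lifts to exactly one edge of the tree graph, so the diagonal of the
    Laplacian of [G] lifts to that of the tree graph. *)
Lemma sum_TGweight a : \sum_b TGweight x a b = \sum_t x (tree_root a) t.
Proof.
under eq_bigr do rewrite TGweightE.
rewrite exchange_big; apply: eq_bigr => t _; rewrite -mulr_sumr.
under eq_bigr do rewrite -[_%:R]mulr1.
by rewrite sum_pred1 mulr1.
Qed.

(* One minus [y + Laplacian] of [G]; its lift is one minus [y + Laplacian] of the tree graph. *)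
Definition walk_mx u t : {poly R} :=
  if u == t then 1 - 'X - (\sum_s x u s)%:P else (x u t)%:P.

Lemma walk_mx_support u t : walk_mx u t != 0 -> step_or_stay E u t.
Proof.
rewrite /walk_mx /step_or_stay; case: (u =P t) => //= _; apply: contraNT => /x0 ->.
by rewrite polyC0.
Qed.

Lemma loop0 u : x u u = 0.
Proof. by rewrite x0 // irrE. Qed.

Lemma walk_mxE u t : walk_mx u t = (u == t)%:R * (1 - 'X - (\sum_s x u s)%:P) + (x u t)%:P.
Proof.
rewrite /walk_mx; case: eqP => [->|]; first by rewrite loop0 polyC0 addr0 mul1r.
by rewrite mul0r add0r.
Qed.

Lemma det_lift_tree_graph :
  \det (1%:M - lift_mx (@tree_root V E) (@tree_step V E) walk_mx) =
  char_laplacian (@TGweight V E R x).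
Proof.
congr (\det _); apply/matrixP=> i j; rewrite !mxE inE.
set a := enum_val i; set b := enum_val j.
have ab : (a == b) = (i == j) by rewrite (inj_eq enum_val_inj).
(* A loop at the root leaves the tree unchanged, so the diagonal entries of [walk_mx] lift to
   diagonal entries. *)
have stay : tree_step a (tree_root a) = a.
  have st : step_or_stay E (tree_root a) (tree_root a) by rewrite /step_or_stay eqxx.
  apply: (tree_fun_inj irrE); rewrite tree_fun_step //; apply/ffunP=> u; rewrite ffunE orbb.
  by case: eqP => // ->; rewrite tree_fun_root.
under eq_bigr do rewrite walk_mxE mulrDl -mulrA.
rewrite big_split /= sum_pred1 stay sum_TGweight ab.
have -> : \sum_t (x (tree_root a) t)%:P * (tree_step a t == b)%:R = (TGweight x a b)%:P.
  rewrite TGweightE rmorph_sum; apply: eq_bigr => t _.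
  by rewrite rmorphM; case: (_ == b); rewrite ?polyC0 ?polyC1.
rewrite polyCB polyCM !polyC_natr.
case: (i == j); rewrite ?mulr1 ?mul1r ?mulr0 ?mul0r ?mulr1n ?mulr0n.
  by rewrite !opprD !opprK !addrA subrr add0r.
by rewrite !add0r.
Qed.

Lemma det_lift_setT :
  \det (1%:M - lift_mx id (fun _ t => t) (restrict_rows walk_mx setT)) = char_laplacian x.
Proof.
congr (\det _); rewrite lift_mx_id; apply/matrixP=> i j.
rewrite !mxE /restrict_rows !inE walk_mxE.
rewrite (inj_eq enum_val_inj) polyCB polyCM !polyC_natr.
case: (i == j); rewrite ?mul1r ?mul0r ?mulr1n ?mulr0n.
  by rewrite !opprD !opprK !addrA subrr add0r.
by rewrite !add0r.
Qed.

(** At 0 the rows in [W] are Laplacian rows and the others are rows of the identity, as in the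
    matrix for forests rooted outside [W]. *)
Lemma det_lift_coef0 (W : {set V}) :
  (\det (1%:M - lift_mx id (fun _ t => t) (restrict_rows walk_mx W)))`_0 = Psi E x (~: W).
Proof.
rewrite (Psi_det _ irrE x0) -horner_coef0 -horner_evalE -det_map_mx; congr (\det _).
rewrite lift_mx_id; apply/matrixP=> i j; rewrite !mxE /= horner_evalE !inE /restrict_rows.
rewrite hornerD hornerN hornerMn hornerC (inj_eq enum_val_inj).
case: ifP => _ /=; last by rewrite horner0 subr0.
rewrite walk_mxE !hornerE (inj_eq enum_val_inj).
case: (i == j); rewrite ?hornerC ?hornerX ?mul1r ?mul0r ?mulr1n ?mulr0n ?hornerE.
  by rewrite subr0 !opprD !opprK !addrA subrr add0r.
by rewrite ?add0r.
Qed.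

Lemma tree_graph_factorization : (forall n (z : R), z *+ n.+1 = 0 -> z = 0) ->
  strongly_connected E setT -> F_TG E x = Phi E x * F_G E x.
Proof.
move=> tf scT; have /set0Pn[u _] : [set: V] != set0 by case/andP: scT.
have tfX n (p : {poly R}) : p *+ n.+1 = 0 -> p = 0.
  by move=> p0; apply/polyP=> i; rewrite coef0; apply: (tf n); rewrite -coefMn p0 coef0.
have := det_tree_graph irrE walk_mx_support tfX.
rewrite det_lift_tree_graph (bigD1 setT) //= mW_setT // expr1 det_lift_setT => Echar.
rewrite /F_TG -(char_laplacian_coef1 TGrel_irr TGweight0) Echar.
(* One term of the coefficient of degree 1 survives, because [char_laplacian x] has no constant
   term. *)
rewrite coefM big_ord_recr big_ord1 /= (char_laplacian_coef0 irrE x0 u) mul0r add0r.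
rewrite (char_laplacian_coef1 irrE x0) mulrC; congr (_ * _).
rewrite -horner_coef0 horner_prod; apply: eq_big => [W|W _]; first by rewrite properT.
by rewrite horner_exp horner_coef0 det_lift_coef0.
Qed.

End TreeGraphFactorization.

(** * Change of the coefficient ring *)

Section Transport.
Variables (V : finType) (E : rel V).

Lemma rmorph_Ftree (X : finType) (ed : rel X) (R S : comNzRingType) (f : {rmorphism R -> S}) w w' :
  (forall u v, f (w u v) = w' u v) -> f (Ftree ed w) = Ftree ed w'.
Proof.
move=> ww'; rewrite rmorph_sum; apply: eq_bigr => T _.
by rewrite rmorph_prod; apply: eq_bigr => e _; apply: ww'.
Qed.

Lemma rmorph_F_TG (R S : comNzRingType) (f : {rmorphism R -> S}) x x' :
  (forall u v, E u v -> f (x u v) = x' u v) -> f (F_TG E x) = F_TG E x'.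
Proof.
move=> xx'; apply: rmorph_Ftree => a b; rewrite rmorph_sum; apply: eq_bigr => e.
by case/and3P=> ee _ _; apply: xx'.
Qed.

Lemma rmorph_weight (R S : comNzRingType) (f : {rmorphism R -> S}) x x' T :
  (forall u v, E u v -> f (x u v) = x' u v) -> subgraph E T -> f (weight x T) = weight x' T.
Proof.
move=> xx' /forallP sT; rewrite rmorph_prod; apply: eq_bigr => e eT.
by apply: xx'; have := sT e; rewrite eT.
Qed.

Lemma rmorph_F_G (R S : comNzRingType) (f : {rmorphism R -> S}) x x' :
  (forall u v, E u v -> f (x u v) = x' u v) -> f (F_G E x) = F_G E x'.
Proof.
move=> xx'; rewrite rmorph_sum; apply: eq_bigr => T /existsP[r /and3P[sT _ _]].
exact: rmorph_weight.
Qed.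

Lemma rmorph_Phi (R S : comNzRingType) (f : {rmorphism R -> S}) x x' :
  (forall u v, E u v -> f (x u v) = x' u v) -> f (Phi E x) = Phi E x'.
Proof.
move=> xx'; rewrite rmorph_prod; apply: eq_bigr => W _; rewrite rmorphXn; congr (_ ^+ _).
rewrite rmorph_sum; apply: eq_bigr => T /and3P[sT _ _]; exact: rmorph_weight.
Qed.

End Transport.

Theorem theorem3p3 (n : nat) (E : rel 'I_n) (R : comNzRingType)
    (x : 'I_n -> 'I_n -> R) :
  irreflexive E -> strongly_connected E [set: 'I_n] ->
  F_TG E x = Phi E x * F_G E x.
Proof.
move=> irrE scT.
pose N := #|{: 'I_n * 'I_n}|.
(* [tree_graph_factorization] wants weights that vanish off [E], whereas [x] is arbitrary there; the
   transport lemmas compare the weights on edges only. *)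
pose X u v : {mpoly int[N]} := if E u v then 'X_(enum_rank (u, v)) else 0.
pose f : {rmorphism {mpoly int[N]} -> R} :=
  mmap (intmul 1) (fun i => x (enum_val i).1 (enum_val i).2).
have fX u v : E u v -> f (X u v) = x u v.
  by move=> uv; rewrite /X uv /f /= mmapX mmap1U enum_rankK.
have tf m (z : {mpoly int[N]}) : z *+ m.+1 = 0 -> z = 0.
  move/eqP; rewrite -mulr_natr mulf_eq0 => /orP[/eqP//|].
  by rewrite -(rmorph_nat (@mpolyC N int)) mpolyC_eq0 Num.Theory.pnatr_eq0.
rewrite -(rmorph_F_TG fX) -(rmorph_Phi fX) -(rmorph_F_G fX) -rmorphM; congr (f _).
by apply: tree_graph_factorization => // u v; rewrite /X => /negPf->.
Qed.
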